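(* Let $f:\mathbb{R}^n_{++}\to\mathbb{R}$ be a symmetric map and let $A\in\mathbb{P}(2n)$. Then $f\circ d:\mathbb{P}(2n)\to\mathbb{R}$ is continuously Gâteaux differentiable at $A$ if and only if $f$ is continuously Gâteaux differentiable at $d(A)$.
   Context: $n$ is a positive integer and $\mathbb{R}^n_{++}$ is the set of vectors in $\mathbb{R}^n$ with strictly positive entries. $\mathbb{S}(2n)$ is the space of real symmetric $2n\times 2n$ matrices with inner product $\langle A,B\rangle=\operatorname{Tr}(A^\top B)$ and the induced (Frobenius) norm; $\mathbb{P}(2n)\subset\mathbb{S}(2n)$ is the open subset of positive definite matrices. For $x\in\mathbb{R}^n$, $D_x:=\operatorname{Diag}(x)\oplus\operatorname{Diag}(x)$. A real $2n\times 2n$ matrix $M$ is symplectic if $M^\top JM=J$ with $J=\begin{pmatrix}0&I_n\\-I_n&0\end{pmatrix}$. By Williamson's theorem, for each $A\in\mathbb{P}(2n)$ there is a unique vector $d(A)=(d_1(A),\dots,d_n(A))\in\mathbb{R}^n_{++}$ with $d_1(A)\le\cdots\le d_n(A)$ such that $M^\top AM=D_{d(A)}$ for some symplectic $M$. A function $f:\mathbb{R}^n_{++}\to\mathbb{R}$ is symmetric if $f(Px)=f(x)$ for all $x\in\mathbb{R}^n_{++}$ and all $n\times n$ permutation matrices $P$. A real function $\phi$ on an open subset of a finite-dimensional Euclidean space $E$ is Gâteaux differentiable at $x$ if there is $\nabla\phi(x)\in E$ with $\lim_{t\searrow0}\frac{\phi(x+tu)-\phi(x)}{t}=\langle\nabla\phi(x),u\rangle$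 for all $u\in E$. It is continuously Gâteaux differentiable at $x$ if it is Gâteaux differentiable at every point of some neighborhood of $x$ and the map $y\mapsto\nabla\phi(y)$ on that neighborhood is continuous at $x$. *)

(* Defs.v *)
From mathcomp Require Import all_boot all_order all_algebra all_fingroup.
From mathcomp Require Import all_classical all_reals all_analysis.

Set Implicit Arguments.
Unset Strict Implicit.
Unset Printing Implicit Defensive.

Import Order.TTheory GRing.Theory Num.Theory.
Import numFieldNormedType.Exports.

Local Open Scope classical_set_scope.
Local Open Scope ring_scope.

(* The entrywise topology that the library puts on 'M[R]_(m, n) is the one
   induced by the Frobenius norm. *)

Section Gateaux.
Context {R : realType} {p q : nat}.

Definition frob_dot (A B : 'M[R]_(p, q)) : R := \tr (A^T *m B).

(* The Euclidean space is the linear subspace [E] of 'M[R]_(p, q), with inner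
   product [frob_dot]. A function on a relatively open subset of [E] is
   represented by a total function [phi]: at a point of that subset, the notions
   below depend only on the values of [phi] on the subset. *)
Definition is_gradient (E : set 'M[R]_(p, q)) (phi : 'M[R]_(p, q) -> R)
    (x g : 'M[R]_(p, q)) : Prop :=
  E g /\
  forall u, E u -> (phi (x + t *: u) - phi x) / t @[t --> 0^'+] --> frob_dot g u.

(* [G] is the gradient map near [x]; its values elsewhere are irrelevant. *)
Definition continuously_gateaux_at (E : set 'M[R]_(p, q))
    (phi : 'M[R]_(p, q) -> R) (x : 'M[R]_(p, q)) : Prop :=
  exists G : 'M[R]_(p, q) -> 'M[R]_(p, q),
    (\forall y \near within E (nbhs x), is_gradient E phi y (G y)) /\
    G y @[y --> within E (nbhs x)] --> G x.

End Gateaux.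

Section Symplectic.
Context {R : realType} {n : nat}.

Definition pos_vec (x : 'cV[R]_n) : Prop := forall i, 0 < x i 0.

Definition perm_invariant (f : 'cV[R]_n -> R) : Prop :=
  forall x, pos_vec x -> forall s : 'S_n, f (perm_mx s *m x) = f x.

Definition sym_mx {m : nat} : set 'M[R]_m := [set A | A \is symmetricmx].

Definition posdef_mx {m : nat} (A : 'M[R]_m) : Prop :=
  A \is symmetricmx /\ forall v : 'cV[R]_m, v != 0 -> 0 < (v^T *m A *m v) 0 0.

Definition Jmx : 'M[R]_(n + n) := block_mx 0 1%:M (- 1%:M) 0.

Definition symplectic_mx (M : 'M[R]_(n + n)) : Prop := M^T *m Jmx *m M = Jmx.

Definition double_diag (x : 'cV[R]_n) : 'M[R]_(n + n) :=
  block_mx (diag_mx x^T) 0 0 (diag_mx x^T).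

Definition is_symplectic_spectrum (A : 'M[R]_(n + n)) (x : 'cV[R]_n) : Prop :=
  [/\ pos_vec x,
      forall i j : 'I_n, (i <= j)%N -> x i 0 <= x j 0 &
      exists2 M, symplectic_mx M & M^T *m A *m M = double_diag x].

(* For positive definite [A] such a vector exists and is unique (Williamson);
   otherwise there is none and the value is 0. *)
Definition symplectic_eigenvalues (A : 'M[R]_(n + n)) : 'cV[R]_n :=
  xget 0 [set x | is_symplectic_spectrum A x].

End Symplectic.

(* Main.v *)
(* A minimiser of tr(D_w M^T A M) over symplectic M, for distinct positive weights w,
   diagonalises A: transvections I + t J y y^T give the first-order condition. A real
   Courant-Fischer argument shows that the symplectic eigenvalues are monotone in A;
   with homogeneity this yields uniqueness of d and its local Lipschitz continuity.

   Let f be continuously differentiable at d(A). Near d(A) it is locally Lipschitz, so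
   its directional derivatives are uniform in the direction, and its gradient g at
   d(B) has equal entries where d(B) has. Hence g is the gradient at d(B) of some
   combination of the functions sum_i x_i^(2k+2). Composed with d, these are
   tr((JB)^(2k+2))/2 up to sign, which are polynomial in B. As d is Lipschitz, f o d
   and that polynomial have the same derivative (1/2) M D_g M^T at B, where
   M^T B M = D_d(B); so no perturbation theory of eigenvalues is needed. Comparing
   with the polynomial attached to A itself gives continuity of the gradient at A,
   because the frames M stay bounded.

   Conversely f(x) = (f o d)(M^-T D_x M^-1) with the fixed frame M of A. *)
Require Import Defs.
From mathcomp Require Import all_boot all_order all_algebra all_fingroup.
From mathcomp Require Import all_classical all_reals all_analysis.
From mathcomp Require Import ring lra.

Import Order.TTheory GRing.Theory Num.Theory.
Import numFieldNormedType.Exports.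

Set Implicit Arguments.
Unset Strict Implicit.
Unset Printing Implicit Defensive.

Local Open Scope classical_set_scope.
Local Open Scope ring_scope.

(** * Topology of matrices *)

Section MatrixTopology.
Context {R : realType}.

Lemma cvg_mxP {p q : nat} {T : Type} (F : set_system T) {FF : Filter F}
    (g : T -> 'M[R]_(p, q)) (M : 'M[R]_(p, q)) :
  g y @[y --> F] --> M <-> forall i j, g y i j @[y --> F] --> M i j.
Proof.
split=> [gM i j|gM].
  apply: (@cvg_comp _ _ _ g (fun N : 'M[R]_(p, q) => N i j) F (nbhs M) _ gM).
  exact: coord_continuous.
move=> A [P MP PA]; apply: (@filterS _ F _ [set y | forall i j, P i j (g y i j)]).
  by move=> y Py; exact: PA.
apply: filter_forall => i; apply: filter_forall => j.
exact: gM (MP i j).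
Qed.

Lemma mx_nbhsP {p q : nat} (x : 'M[R]_(p, q)) (P : set 'M[R]_(p, q)) :
  nbhs x P <-> exists2 e : R, 0 < e &
    forall y : 'M[R]_(p, q), (forall i j, `|y i j - x i j| < e) -> P y.
Proof.
split=> [/nbhs_ballP[e /= e0 xP]|[e e0 xP]].
  by exists e => // y yx; apply: xP; split=> // i j; rewrite /ball /= distrC.
apply/nbhs_ballP; exists e => // y [_ yx]; apply: xP => i j.
by rewrite distrC; exact: yx.
Qed.

Lemma cvg_mulmx {p q r : nat} {T : Type} (F : set_system T) {FF : Filter F}
    (f : T -> 'M[R]_(p, q)) (g : T -> 'M[R]_(q, r)) (a : 'M[R]_(p, q))
    (b : 'M[R]_(q, r)) :
  f y @[y --> F] --> a -> g y @[y --> F] --> b ->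
  f y *m g y @[y --> F] --> a *m b.
Proof.
move=> /cvg_mxP fa /cvg_mxP gb; apply/cvg_mxP => i j; rewrite mxE.
under eq_fun do rewrite mxE.
by apply: cvg_big => [|k _]; [exact: add_continuous|exact: cvgM].
Qed.

Lemma cvg_trmx {p q : nat} {T : Type} (F : set_system T) {FF : Filter F}
    (f : T -> 'M[R]_(p, q)) (a : 'M[R]_(p, q)) :
  f y @[y --> F] --> a -> (f y)^T @[y --> F] --> a^T.
Proof.
move=> /cvg_mxP fa; apply/cvg_mxP => i j; rewrite mxE.
by under eq_fun do rewrite mxE; exact: fa.
Qed.

Lemma cvg_mxtrace {p : nat} {T : Type} (F : set_system T) {FF : Filter F}
    (f : T -> 'M[R]_p) (a : 'M[R]_p) :
  f y @[y --> F] --> a -> \tr (f y) @[y --> F] --> \tr a.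
Proof.
move=> /cvg_mxP fa; apply: cvg_big => [|k _]; [exact: add_continuous|exact: fa].
Qed.

(** Closed bounded sets of row vectors are compact, so the extreme value theorem is transported
    along [vec_mx]. *)
Lemma compact_mx_min {p q : nat} (K : set 'M[R]_(p, q)) (phi : 'M[R]_(p, q) -> R)
    (C : R) (M1 : 'M[R]_(p, q)) :
  0 <= C -> closed K -> (forall M, K M -> forall i j, `|M i j| <= C) -> continuous phi ->
  K M1 -> exists2 M, K M & forall N, K N -> phi M <= phi N.
Proof.
move=> C_ge0 clK bK cphi KM1.
have cvec : continuous (@vec_mx R p q).
  move=> v; apply: (proj2 (cvg_mxP (F := nbhs v) _ _)) => i j.
  rewrite mxE; under eq_fun do rewrite mxE.
  exact: coord_continuous.
have cK : compact (vec_mx @^-1` K).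
  apply: bounded_closed_compact; last first.
    by apply: closed_comp => // v _; exact: cvec.
  exists C; split; first exact: num_real.
  move=> x Cx v Kv.
  have C0 : 0 <= x by rewrite (le_trans C_ge0)// ltW.
  change (`|v| <= x); rewrite [leLHS]/Num.norm /= mx_normrE.
  apply/bigmax_leP; split => //= -[i j] _ /=.
  rewrite (ord1 i) -[v]vec_mxK; case/mxvec_indexP: j => a b.
  by rewrite mxvecE (le_trans (bK _ Kv a b)) // ltW.
have [||v Kv vmin] := compact_EVT_min (f := phi \o vec_mx) _ cK.
- by exists (mxvec M1); rewrite /= mxvecK.
- by apply: continuous_subspaceT => v; apply: continuous_comp; [exact: cvec|exact: cphi].
move: Kv; rewrite inE => Kv; exists (vec_mx v) => // N KN.
have := vmin (mxvec N); rewrite inE.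
by rewrite /= mxvecK; apply.
Qed.

End MatrixTopology.

(** * Symplectic matrices *)

Section SymplecticAlgebra.
Context {R : realType} {n : nat}.
Implicit Types (M N A B : 'M[R]_(n + n)) (x w : 'cV[R]_n).
Local Notation J := (@Jmx R n).

Lemma tr_Jmx : J^T = - J.
Proof.
by rewrite /Jmx tr_block_mx opp_block_mx !trmx0 linearN /= trmx1 !oppr0 opprK.
Qed.

Lemma mul_Jmx : J *m J = - 1%:M.
Proof.
rewrite /Jmx mulmx_block !mul0mx !mulmx0 !mul1mx !mulNmx !mul1mx !add0r !addr0.
by rewrite scalar_mx_block opp_block_mx !oppr0.
Qed.

Lemma symplectic_mulVmx M : symplectic_mx M -> (- (J *m M^T *m J)) *m M = 1%:M.
Proof. by move=> sM; rewrite mulNmx -!mulmxA [M^T *m _]mulmxA sM mul_Jmx opprK. Qed.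

Lemma symplectic_unitmx M : symplectic_mx M -> M \in unitmx.
Proof. by move=> /symplectic_mulVmx/mulmx1_unit[]. Qed.

Lemma symplectic_invmx M : symplectic_mx M -> invmx M = - (J *m M^T *m J).
Proof.
move=> sM; rewrite -[LHS]mul1mx -(symplectic_mulVmx sM).
by rewrite mulmxK ?symplectic_unitmx.
Qed.

Lemma symplectic_tr M : symplectic_mx M -> M *m J *m M^T = J.
Proof.
move=> sM; have := mulmxV (symplectic_unitmx sM).
rewrite symplectic_invmx// mulmxN !mulmxA => MJ.
rewrite -[LHS]mulmx1 -[1%:M]opprK -mul_Jmx mulmxN mulmxA -mulNmx.
by rewrite MJ mul1mx.
Qed.

Lemma symplectic_mul M N : symplectic_mx M -> symplectic_mx N ->
  symplectic_mx (M *m N).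
Proof.
by rewrite /symplectic_mx => sM sN; rewrite trmx_mul -!mulmxA [M^T *m _]mulmxA
  [M^T *m _ *m _]mulmxA sM mulmxA.
Qed.

Lemma symplectic1 : symplectic_mx (1%:M : 'M[R]_(n + n)).
Proof. by rewrite /symplectic_mx trmx1 mul1mx mulmx1. Qed.

Lemma quad_Jmx (y : 'cV[R]_(n + n)) : y^T *m J *m y = 0.
Proof.
have : (y^T *m J *m y)^T = - (y^T *m J *m y).
  by rewrite !trmx_mul trmxK tr_Jmx mulNmx mulmxN mulmxA.
move: (y^T *m J *m y) => c /matrixP/(_ 0 0); rewrite !mxE => h.
by apply/matrixP => i j; rewrite !ord1 mxE; lra.
Qed.

(** With Z = y y^T, the t^2 term vanishes because y^T J y = 0, and the terms linear in t cancel by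
    J^2 = -1. *)
Lemma symplectic_transvection (t : R) (y : 'cV[R]_(n + n)) :
  symplectic_mx (1%:M + t *: (J *m (y *m y^T))).
Proof.
have ZJZ : y *m y^T *m J *m (y *m y^T) = 0.
  by rewrite !mulmxA -[y *m y^T *m J]mulmxA -[y *m (_ *m J) *m y]mulmxA quad_Jmx
    mulmx0 mul0mx.
have trZ : (y *m y^T)^T = y *m y^T by rewrite trmx_mul trmxK.
move: (y *m y^T) ZJZ trZ => Z ZJZ trZ; rewrite /symplectic_mx.
have -> : (1%:M + t *: (J *m Z))^T = 1%:M - t *: (Z *m J).
  by rewrite linearD linearZ /= trmx1 trmx_mul trZ tr_Jmx mulmxN scalerN.
have -> : (1%:M - t *: (Z *m J)) *m J = J + t *: Z.
  by rewrite mulmxBl mul1mx -scalemxAl -mulmxA mul_Jmx mulmxN mulmx1 scalerN opprK.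
rewrite mulmxDr mulmx1 mulmxDl -scalemxAl -!scalemxAr !mulmxA ZJZ !scaler0 addr0.
by rewrite mul_Jmx mulNmx mul1mx scalerN addrK.
Qed.

Lemma double_diagJ x : J *m double_diag x = double_diag x *m J.
Proof.
rewrite /Jmx /double_diag !mulmx_block !mul0mx !mulmx0 !add0r !addr0.
by rewrite mul1mx mulmx1 !mulNmx !mulmxN mul1mx mulmx1.
Qed.

Lemma double_diag_tr x : (double_diag x)^T = double_diag x.
Proof. by rewrite /double_diag tr_block_mx !trmx0 !tr_diag_mx. Qed.

Definition double_perm (s : 'S_n) : 'M[R]_(n + n) :=
  block_mx (perm_mx s) 0 0 (perm_mx s).

Lemma symplectic_perm (s : 'S_n) : symplectic_mx (double_perm s)^T.
Proof.
rewrite /symplectic_mx trmxK /double_perm /Jmx tr_block_mx !trmx0 !mulmx_block.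
rewrite !mul0mx !mulmx0 !add0r !addr0 !mulmx1 !mulmxN !mulmx1 !mulNmx.
by rewrite tr_perm_mx -perm_mxM mulgV perm_mx1 !mul0mx ?oppr0.
Qed.

Lemma double_diag_perm (s : 'S_n) x :
  double_perm s *m double_diag x *m (double_perm s)^T =
  double_diag (perm_mx s *m x).
Proof.
rewrite /double_perm /double_diag tr_block_mx !trmx0 !mulmx_block.
rewrite !mul0mx !mulmx0 !add0r !addr0 !mul0mx.
suff -> : perm_mx s *m diag_mx x^T *m (perm_mx s)^T = diag_mx (perm_mx s *m x)^T by [].
rewrite tr_perm_mx -row_permE -col_permE -row_permE.
by apply/matrixP => i j; rewrite !mxE (inj_eq perm_inj); case: eqP => [->|].
Qed.

Lemma perm_pos_vec (s : 'S_n) x : pos_vec x -> pos_vec (perm_mx s *m x).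
Proof. by move=> x0 i; rewrite -row_permE mxE. Qed.

Lemma perm_sorted x : exists s : 'S_n,
  forall i j : 'I_n, (i <= j)%N -> (perm_mx s *m x) i 0 <= (perm_mx s *m x) j 0.
Proof.
pose t := [tuple x i 0 | i < n].
have /tuple_permP[s st] : perm_eq (sort <=%R t) t by rewrite perm_sort.
exists s => i j ij; rewrite -!row_permE !mxE.
have E k : x (s k) 0 = nth 0 (sort <=%R t) k.
  by rewrite st (nth_mktuple _ 0 k) tnth_mktuple.
have : sorted <=%R (sort <=%R t) by apply: sort_sorted; exact: le_total.
rewrite !E => /(sorted_leq_nth le_trans le_refl); apply => //.
  by rewrite inE size_sort size_tuple.
by rewrite inE size_sort size_tuple.
Qed.

(** A permutation acting alike on both blocks is symplectic, so any positive diagonal form can be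
    reordered increasingly. *)
Lemma is_symplectic_spectrum_perm A x M : pos_vec x -> symplectic_mx M ->
  M^T *m A *m M = double_diag x ->
  exists s : 'S_n, is_symplectic_spectrum A (perm_mx s *m x).
Proof.
move=> x0 sM MA; have [s xs] := perm_sorted x.
exists s; split=> //; first exact: perm_pos_vec.
exists (M *m (double_perm s)^T); first exact: symplectic_mul sM (symplectic_perm s).
by rewrite trmx_mul trmxK -double_diag_perm -MA !mulmxA.
Qed.

End SymplecticAlgebra.

(** * Positive definite quadratic forms *)

Section Posdef.
Context {R : realType} {m : nat}.
Implicit Types (A : 'M[R]_m) (v z : 'cV[R]_m).

Lemma symmetricmxP A : reflect (A^T = A) (A \is symmetricmx).
Proof.
apply: (iffP (is_hermitianmxP _ _ _)); rewrite expr0 scale1r => AE.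
  by rewrite {2}AE; apply/matrixP => i j; rewrite !mxE.
by rewrite -{1}AE; apply/matrixP => i j; rewrite !mxE.
Qed.

Definition qform A v : R := (v^T *m A *m v) 0 0.

Lemma qformDZ A v z (s : R) : A \is symmetricmx ->
  qform A (v + s *: z) = qform A v + s *+ 2 * (z^T *m A *m v) 0 0 + s ^+ 2 * qform A z.
Proof.
move=> /symmetricmxP AT; rewrite /qform.
have E : (v^T *m A *m z) 0 0 = (z^T *m A *m v) 0 0.
  by rewrite -[in LHS](trmxK z) -[in LHS]AT -!trmx_mul mxE mulmxA.
have -> : (v + s *: z)^T = v^T + s *: z^T by rewrite linearD linearZ.
rewrite !mulmxDl !mulmxDr -!scalemxAl -!scalemxAr.
rewrite !mxE in E *; rewrite E; ring.
Qed.

Lemma qformB A B v : qform (A - B) v = qform A v - qform B v.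
Proof. by rewrite /qform mulmxBr mulmxBl !mxE. Qed.

Lemma qform_ge0 A v : posdef_mx A -> 0 <= qform A v.
Proof.
move=> [_ Apd]; have [->|/Apd/ltW//] := eqVneq v 0.
by rewrite /qform mulmx0 mxE.
Qed.

Lemma posdef_unitmx A : posdef_mx A -> A \in unitmx.
Proof.
move=> [Asym Apd]; rewrite unitmxE unitfE; apply/negP => /det0P[v v0 vA].
have := Apd v^T; rewrite trmxK vA mul0mx mxE ltxx => h; suff: false by [].
by apply: h; apply: contra v0 => /eqP v0; rewrite -(trmxK v) v0 trmx0.
Qed.

(** This is Cauchy-Schwarz for the form of [A], as v_i is the [A]-product of v with A^-1 e_i. *)
Lemma posdef_coord A : posdef_mx A ->
  exists2 c : R, 0 < c & forall v i, v i 0 ^+ 2 <= c * qform A v.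
Proof.
move=> Apd; have Au := posdef_unitmx Apd; have [/[dup] Asym /symmetricmxP AT pos] := Apd.
pose z i := invmx A *m delta_mx i (0 : 'I_1).
have zA i : (z i)^T *m A = 'e_i.
  by rewrite -[A]AT -trmx_mul mulKVmx// trmx_delta.
have c0 i : 0 < qform A (z i).
  apply: pos; apply: contraTneq (oner_neq0 R) => z0; rewrite negbK.
  have := zA i; rewrite z0 trmx0 mul0mx => /matrixP/(_ 0 i).
  by rewrite !mxE !eqxx => ->.
(* The summand 1 keeps the constant positive in dimension 0. *)
exists (1 + \sum_i qform A (z i)).
  by rewrite ltr_wpDr// sumr_ge0// => i _; exact: ltW.
move=> v i; apply: (@le_trans _ _ (qform A (z i) * qform A v)); last first.
  rewrite ler_wpM2r ?qform_ge0// (bigD1 i)//= addrCA lerDl addr_ge0//.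
  by rewrite sumr_ge0// => k _; exact: ltW.
(* The form is evaluated at its minimum on the line through v in direction z_i. *)
have := qform_ge0 (v + (- (v i 0 / qform A (z i))) *: z i) Apd.
rewrite qformDZ// zA -rowE mxE; have := c0 i; move: (qform A (z i)) => c cp.
rewrite -(pmulr_rge0 _ cp); set q := qform A v; set x := v i 0.
suff -> : c * (q + - (x / c) *+ 2 * x + (- (x / c)) ^+ 2 * c) = c * q - x ^+ 2.
  by rewrite subr_ge0.
by field; rewrite gt_eqF.
Qed.

End Posdef.

(** * Williamson's theorem *)

Section Williamson.
Context {R : realType} {n : nat}.
Implicit Types (M N A B : 'M[R]_(n + n)) (x w : 'cV[R]_n).
Local Notation J := (@Jmx R n).

Definition dbl x : 'rV[R]_(n + n) := row_mx x^T x^T.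

Lemma double_diag_dbl x : double_diag x = diag_mx (dbl x).
Proof. by rewrite /dbl diag_mx_row. Qed.

Lemma closed_symplectic : closed [set M | @symplectic_mx R n M].
Proof.
apply: (@closed_comp _ _ (fun M => M^T *m J *m M) [set J]).
  move=> M _; apply: (cvg_mulmx (F := nbhs M)); last exact: cvg_id.
  apply: (cvg_mulmx (F := nbhs M)); last exact: cvg_cst.
  by apply: (cvg_trmx (F := nbhs M)); exact: cvg_id.
exact: accessible_closed_set1 (hausdorff_accessible (@norm_hausdorff _ _)) _.
Qed.

Definition wtrace w A M := \tr (double_diag w *m (M^T *m A *m M)).

Lemma wtrace_continuous w A : continuous (wtrace w A).
Proof.
move=> M; apply: (cvg_mxtrace (F := nbhs M)).
apply: (cvg_mulmx (F := nbhs M)); first exact: cvg_cst.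
apply: (cvg_mulmx (F := nbhs M)); last exact: cvg_id.
apply: (cvg_mulmx (F := nbhs M)); last exact: cvg_cst.
by apply: (cvg_trmx (F := nbhs M)); exact: cvg_id.
Qed.

Lemma wtraceE w A M : wtrace w A M = \sum_k dbl w 0 k * qform A (col k M).
Proof.
rewrite /wtrace double_diag_dbl mul_diag_mx /mxtrace; apply: eq_bigr => k _.
rewrite !mxE; congr (_ * _); rewrite /qform mxE; apply: eq_bigr => l _.
by rewrite tr_col -row_mul !mxE.
Qed.

Definition half_ord (k : 'I_(n + n)) : 'I_n :=
  match fintype.split k with inl i => i | inr i => i end.

Lemma dblE x k : dbl x 0 k = x (half_ord k) 0.
Proof. by rewrite /dbl /half_ord mxE; case: (fintype.split k) => i; rewrite mxE. Qed.

(** The sublevel set of the identity is compact: with weights at least 1, [wtrace] bounds the form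
    of [A] on each column, hence each entry. *)
Lemma wtrace_min w A : posdef_mx A -> (forall i, 1 <= w i 0) ->
  exists2 M, symplectic_mx M & forall N, symplectic_mx N -> wtrace w A M <= wtrace w A N.
Proof.
move=> Apd w1; have [c c0 cA] := posdef_coord Apd.
have d1 k : 1 <= dbl w 0 k by rewrite dblE.
have wt0 M : 0 <= wtrace w A M.
  rewrite wtraceE sumr_ge0// => k _; rewrite mulr_ge0 ?qform_ge0//.
  exact: le_trans (d1 k).
pose K := [set M | symplectic_mx M] `&` [set M | wtrace w A M <= wtrace w A 1%:M].
(* The entry bound has the form 1 + T because y^2 <= T implies y <= 1 + T. *)
have [|||||M [sM MM] Mmin] :=
  @compact_mx_min R _ _ K (wtrace w A) (1 + c * wtrace w A 1%:M) 1%:M.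
- by rewrite addr_ge0// mulr_ge0// ltW.
- apply: closedI; first exact: closed_symplectic.
  apply: (@closed_comp _ _ (wtrace w A) [set t | t <= wtrace w A 1%:M]); last exact: closed_le.
  by move=> ? _; exact: wtrace_continuous.
- move=> M [_ MM] i k.
  have : M i k ^+ 2 <= c * wtrace w A 1%:M.
    have := cA (col k M) i; rewrite mxE => /le_trans; apply.
    rewrite ler_pM2l//; apply: le_trans MM; rewrite wtraceE (bigD1 k)//=.
    apply: (@le_trans _ _ (dbl w 0 k * qform A (col k M))).
      by rewrite ler_peMl ?qform_ge0.
    rewrite lerDl sumr_ge0// => l _; rewrite mulr_ge0 ?qform_ge0//.
    exact: le_trans (d1 l).
  rewrite -real_normK ?num_real//; set y := `|_|; nra.
- exact: wtrace_continuous.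
- by split=> //=; exact: symplectic1.
exists M => // N sN; have [NM|/ltW MN] := leP (wtrace w A N) (wtrace w A 1%:M).
  exact: Mmin.
exact: le_trans MN.
Qed.

Lemma mxtrace_sym3 {m : nat} (W X B : 'M[R]_m) : W^T = W -> B^T = B ->
  \tr (W *m (X^T *m B)) = \tr (W *m (B *m X)).
Proof.
by move=> WT BT; rewrite -mxtrace_tr !trmx_mul trmxK BT WT [RHS]mxtrace_mulC.
Qed.

(** At t = -a / (1 + |b|) the linear term dominates, and the value is negative unless a = 0. *)
Lemma quad_ge0_lin (a b : R) : (forall t, 0 <= t * (a *+ 2 + t * b)) -> a = 0.
Proof.
move=> /(_ (- a / (1 + `|b|))).
have k0 : 0 < 1 + `|b| by rewrite ltr_wpDr.
have : b <= (1 + `|b|) - 1 by rewrite addrC addKr ler_norm.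
move: k0; move: (1 + `|b|) => k k0 bk.
rewrite -(pmulr_rge0 _ (exprn_gt0 2 k0)).
have -> : k ^+ 2 * (- a / k * (a *+ 2 + - a / k * b)) = a ^+ 2 * (b - k *+ 2).
  by field; rewrite gt_eqF.
move=> h; apply/eqP; rewrite -sqrf_eq0 eq_le sqr_ge0 andbT; nra.
Qed.

Lemma qform0_skew {m : nat} (Q : 'M[R]_m) : (forall y, qform Q y = 0) -> Q^T = - Q.
Proof.
move=> Q0; apply/matrixP => i j; rewrite !mxE.
have qE (k l : 'I_m) : (delta_mx k (0 : 'I_1))^T *m Q *m delta_mx l 0 = (Q k l)%:M.
  rewrite trmx_delta -rowE -colE; apply/matrixP => a b; rewrite !ord1 !mxE /=.
  by rewrite mulr1n.
have := Q0 (delta_mx i 0 + delta_mx j 0); have := Q0 (delta_mx i 0); have := Q0 (delta_mx j 0).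
rewrite /qform [(_ + _)^T]linearD /= !mulmxDl !mulmxDr !qE !mxE /= !mulr1n => -> -> /eqP.
by rewrite add0r addr0 addr_eq0 => /eqP ->; rewrite opprK.
Qed.

(** Along the transvections 1 + t J y y^T the linear coefficient of [wtrace] is 2 y^T W B J y. It
    vanishes for every y, so W B J is skew, which is the claimed identity. *)
Lemma wtrace_first_order w A M : A \is symmetricmx -> symplectic_mx M ->
  (forall N, symplectic_mx N -> wtrace w A M <= wtrace w A N) ->
  double_diag w *m (M^T *m A *m M) *m J = J *m (M^T *m A *m M) *m double_diag w.
Proof.
move=> /symmetricmxP AT sM Mmin; set B := M^T *m A *m M; set W := double_diag w.
have BT : B^T = B by rewrite /B !trmx_mul trmxK AT mulmxA.
have WT : W^T = W := double_diag_tr w.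
pose Q := W *m B *m J.
have Q0 (y : 'cV_(n + n)) : qform Q y = 0.
  pose X := J *m (y *m y^T).
  have quad (t : R) : 0 <= t * (\tr (W *m (B *m X)) *+ 2 + t * \tr (W *m (X^T *m B *m X))).
    have := Mmin _ (symplectic_mul sM (symplectic_transvection t y)).
    rewrite /wtrace -/W -/B -/X trmx_mul.
    have -> : (1%:M + t *: X)^T *m M^T *m A *m (M *m (1%:M + t *: X)) =
        (1%:M + t *: X)^T *m B *m (1%:M + t *: X) by rewrite /B !mulmxA.
    have -> : (1%:M + t *: X)^T = 1%:M + t *: X^T by rewrite linearD linearZ /= trmx1.
    rewrite mulmxDl mul1mx -scalemxAl !mulmxDr !mulmx1 !mulmxDl -!scalemxAr -!scalemxAl.
    rewrite !linearD /= !linearZ /= mxtrace_sym3// => le_t; move: le_t.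
    set a := \tr (_ *m (B *m _)); set b := \tr (_ *m (_ *m B *m X)); rewrite -subr_ge0.
    by congr (0 <= _); ring.
  have <- := quad_ge0_lin quad.
  rewrite /X !mulmxA mxtrace_mulC !mulmxA /qform /Q /mxtrace.
  by rewrite big_ord_recl big_ord0 addr0 !mulmxA.
have -> : J *m B *m W = - Q^T.
  by rewrite trmx_mul trmx_mul BT WT tr_Jmx mulNmx opprK [RHS]mulmxA.
by rewrite qform0_skew// opprK.
Qed.

(* Comparing entries, B = [[P, Q], [Q', S]] must satisfy w_i P_ij = S_ij w_j and
   w_i S_ij = P_ij w_j, so that (w_i^2 - w_j^2) P_ij = 0. *)
Lemma commute_double_diag w B : B \is symmetricmx -> (forall i, 0 < w i 0) ->
  (forall i j, w i 0 = w j 0 -> i = j) ->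
  double_diag w *m B *m J = J *m B *m double_diag w ->
  exists x, B = double_diag x.
Proof.
move=> /symmetricmxP BT w0 winj.
move: BT; rewrite -[B]submxK.
move: (ulsubmx B) (ursubmx B) (dlsubmx B) (drsubmx B) => P Q Q' S.
rewrite tr_block_mx => /eq_block_mx[_ _ QQ' _].
rewrite /double_diag /Jmx !mulmx_block !mul0mx !mulmx0 !add0r !addr0.
rewrite !(mul1mx, mulNmx, mulmxN, mulmx1, opprK).
move=> /eq_block_mx[/matrixP QE /matrixP PS /matrixP SP /matrixP Q'E].
have neq i j : i != j -> w i 0 ^+ 2 != w j 0 ^+ 2.
  apply: contraNneq => /eqP; rewrite eqrXn2 ?ltW// => /eqP/winj/eqP; exact.
have Q'Q i j : Q' i j = Q j i by rewrite -QQ' mxE.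
have diagPS i j : P i j = P i i *+ (i == j) /\ S i j = P i i *+ (i == j).
  have := PS i j; have := SP i j; rewrite !mul_diag_mx !mul_mx_diag !mxE => e1 e2.
  have [<-|/neq ij] := eqVneq i j.
    split=> //; apply: (mulIf (lt0r_neq0 (w0 i))).
    by have := PS i i; rewrite mul_diag_mx mul_mx_diag !mxE => <-; rewrite mulrC.
  have P0 : P i j = 0.
    apply/eqP; have : (w i 0 ^+ 2 - w j 0 ^+ 2) * P i j == 0.
      have -> : (w i 0 ^+ 2 - w j 0 ^+ 2) * P i j = w i 0 * (w i 0 * P i j - S i j * w j 0)
          + w j 0 * (- (P i j * w j 0) - - (w i 0 * S i j)) by ring.
      by rewrite e2 e1 !subrr !mulr0 addr0.
    by rewrite mulf_eq0 subr_eq0 (negPf ij).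
  split=> //; apply: (mulfI (lt0r_neq0 (w0 i))).
  by rewrite P0 mul0r oppr0 in e1; rewrite mulr0; lra.
have Q0 : Q = 0.
  apply/matrixP => i j; rewrite mxE; have := QE i j; have := Q'E i j.
  rewrite !mul_diag_mx !mul_mx_diag !mxE => e1 e2.
  (* On the diagonal the squared weights coincide; there Q'_ii = Q_ii turns the relation into 2 w_i
     Q_ii = 0. *)
  have [ij|/neq ij] := eqVneq i j.
    subst j; move: e1; rewrite Q'Q => e1; have := w0 i; nra.
  have : (w i 0 ^+ 2 - w j 0 ^+ 2) * Q i j == 0.
    have -> : (w i 0 ^+ 2 - w j 0 ^+ 2) * Q i j = w j 0 * (- (Q i j * w j 0) - w i 0 * Q' i j)
        - w i 0 * (- (w i 0 * Q i j) - Q' i j * w j 0) by ring.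
    by rewrite e2 e1 !subrr !mulr0 subr0.
  by rewrite mulf_eq0 subr_eq0 (negPf ij) => /eqP.
exists (\col_i P i i); rewrite /double_diag; congr block_mx => //.
- by apply/matrixP => i j; rewrite !mxE; have [-> _] := diagPS i j; case: eqP => [->|].
- by rewrite -QQ' Q0 trmx0.
- by apply/matrixP => i j; rewrite !mxE; have [_ ->] := diagPS i j; case: eqP => [->|].
Qed.

Lemma qform_congr {m p : nat} (A : 'M[R]_m) (M : 'M[R]_(m, p)) (v : 'cV_p) :
  qform (M^T *m A *m M) v = qform A (M *m v).
Proof. by rewrite /qform trmx_mul !mulmxA. Qed.

Lemma williamson A : posdef_mx A -> exists x, is_symplectic_spectrum A x.
Proof.
(* The weights 1, ..., n are distinct and at least 1. *)
move=> Apd; pose w : 'cV[R]_n := \col_i (val i).+1%:R.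
have [|M sM Mmin] := wtrace_min (w := w) Apd.
  by move=> i; rewrite mxE ler1n.
have [Asym Apos] := Apd; have fo := wtrace_first_order Asym sM Mmin.
have Bsym : M^T *m A *m M \is symmetricmx.
  by apply/symmetricmxP; rewrite !trmx_mul trmxK (symmetricmxP _ Asym) mulmxA.
have [|i j|x Bx] := commute_double_diag Bsym _ _ fo.
- by move=> i; rewrite mxE ltr0n.
- by rewrite !mxE => /eqP; rewrite eqr_nat eqSS => /eqP/val_inj.
(* x_i is the value of the form of [A] at a column of the invertible matrix M. *)
have x0 : pos_vec x.
  move=> i; have := Apos (col (lshift n i) M).
  have -> : ((col (lshift n i) M)^T *m A *m col (lshift n i) M) 0 0 = x i 0.
    have <- : double_diag x (lshift n i) (lshift n i) = x i 0.
      by rewrite /double_diag block_mxEul !mxE eqxx.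
    rewrite tr_col -row_mul -Bx [RHS]mxE mxE.
    by apply: eq_bigr => k _; rewrite !mxE.
  apply; apply: contraTneq (symplectic_unitmx sM) => M0.
  rewrite unitmxE unitfE negbK -det_tr; apply/det0P; exists 'e_(lshift n i).
    by apply/eqP => /matrixP/(_ 0 (lshift n i)); rewrite !mxE !eqxx => /eqP; rewrite oner_eq0.
  by rewrite -rowE -tr_col M0 trmx0.
have [s xs] := is_symplectic_spectrum_perm x0 sM Bx.
by exists (perm_mx s *m x).
Qed.

End Williamson.

(** * Monotonicity and Lipschitz continuity of the symplectic eigenvalues *)

Section Monotone.
Context {R : realType} {n : nat}.
Implicit Types (M N A B : 'M[R]_(n + n)) (x y : 'cV[R]_n).
Local Notation J := (@Jmx R n).

Lemma qform_double_diag x (v : 'cV[R]_(n + n)) :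
  qform (double_diag x) v = \sum_k dbl x 0 k * v k 0 ^+ 2.
Proof.
rewrite /qform double_diag_dbl mul_mx_diag mxE; apply: eq_bigr => k _.
by rewrite !mxE; ring.
Qed.

Lemma qform_double_diagJ x v : qform (double_diag x) (J *m v) = qform (double_diag x) v.
Proof.
rewrite -qform_congr tr_Jmx -mulmxA -double_diagJ mulmxA mulNmx mul_Jmx.
by rewrite opprK mul1mx.
Qed.

Lemma dot_cV {m : nat} (a b : 'cV[R]_m) : (a^T *m b) 0 0 = \sum_k a k 0 * b k 0.
Proof. by rewrite mxE; apply: eq_bigr => k _; rewrite mxE. Qed.

Lemma singular_cV {m : nat} (S : 'M[R]_m) i : row i S = 0 ->
  exists2 p : 'cV_m, p != 0 & S *m p = 0.
Proof.
move=> Si; suff /det0P[v v0 vS] : \det S^T == 0.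
  exists v^T; last by rewrite -[S]trmxK -trmx_mul vS trmx0.
  by apply: contra v0 => /eqP v0; rewrite -[v]trmxK v0 trmx0.
rewrite det_tr; apply/det0P; exists 'e_i; last by rewrite -rowE.
by apply/eqP => /matrixP/(_ 0 i); rewrite !mxE !eqxx => /eqP; rewrite oner_eq0.
Qed.

Lemma half_lshift (j : 'I_n) : half_ord (lshift n j) = j.
Proof. by rewrite /half_ord (unsplitK (inl j)). Qed.

(* The inverses of the symplectic eigenvalues of A are the positive eigenvalues of the
   Hermitian form of iJ relative to A, and on z = u + iv the former is 2 u^T J v.
   This is the Courant-Fischer argument: take z = M'(p - i J p) nonzero, with p
   supported on the first j pairs for B, and orthogonal to the eigenvectors of the
   first j - 1 positive eigenvalues for A. *)
Lemma symplectic_spectrum_mono A B x y : is_symplectic_spectrum A x ->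
  is_symplectic_spectrum B y -> (forall v, qform A v <= qform B v) ->
  forall j, x j 0 <= y j 0.
Proof.
move=> [x0 xle [M sM MA]] [y0 yle [M' sM' MB]] AB j.
have uM := symplectic_unitmx sM.
have [K MK] : exists K, M *m K = M' by exists (invmx M *m M'); rewrite mulKVmx.
have sK : K^T *m J *m K = J.
  rewrite -[RHS]sM' -MK trmx_mul !mulmxA -[K^T *m M^T *m J *m M]mulmxA.
  by rewrite -[K^T *m M^T *m _]mulmxA [M^T *m _]mulmxA sM.
(* S p = 0 collects the linear conditions on p: p_k = 0 on the pairs after j, and a_k + b_k = 0 on
   the pairs before j. The rows of pair j are zero, so a nonzero solution exists. *)
pose S := diag_mx (\row_k (j < half_ord k)%N%:R) +
  diag_mx (\row_k (half_ord k < j)%N%:R) *m (K - J *m K *m J).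
have [|p p0 Sp] := @singular_cV _ S (lshift n j).
  rewrite /S mul_diag_mx; apply/rowP => k; rewrite !mxE half_lshift ltnn.
  by rewrite mul0r addr0 mul0rn.
pose a := K *m p; pose b := - (J *m K *m J *m p).
have sE k : (j < half_ord k)%N%:R * p k 0 + (half_ord k < j)%N%:R * (a k 0 + b k 0) = 0.
  move/matrixP: Sp => /(_ k 0); rewrite /S mulmxDl -mulmxA mulmxBl !mul_diag_mx.
  by rewrite !mxE.
have p_supp k : (j < half_ord k)%N -> p k 0 = 0.
  by move=> jk; have := sE k; rewrite jk ltnNge ltnW//= mul1r mul0r addr0.
have ab_supp k : (half_ord k < j)%N -> a k 0 = - b k 0.
  move=> jk; have := sE k; rewrite jk ltnNge ltnW//= mul1r mul0r add0r => /eqP.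
  by rewrite addr_eq0 => /eqP.
(* Since K is symplectic, a^T b = - p^T K^T J K J p = p^T p. *)
have abp : \sum_k a k 0 * b k 0 = \sum_k p k 0 ^+ 2.
  under [RHS]eq_bigr do rewrite expr2; rewrite -!dot_cV.
  rewrite /a /b mulmxN trmx_mul !mulmxA -[p^T *m K^T *m J *m K]mulmxA.
  rewrite -[p^T *m K^T *m _]mulmxA [K^T *m _]mulmxA sK.
  by rewrite -[p^T *m J *m J]mulmxA mul_Jmx mulmxN mulmx1 mulNmx opprK.
(* The two vectors are M' p and M' J p, on which the form of B is diagonal; p lives on pairs up to
   j, where y_k <= y_j. *)
have ub : qform A (M *m a) + qform A (M *m (J *m b)) <= y j 0 * (\sum_k p k 0 ^+ 2) *+ 2.
  have Ma : M *m a = M' *m p by rewrite /a mulmxA MK.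
  have MJb : M *m (J *m b) = M' *m (J *m p).
    by rewrite /b !mulmxN !mulmxA -[M *m J *m J]mulmxA mul_Jmx mulmxN mulmx1 !mulNmx opprK MK.
  rewrite Ma MJb mulr2n; apply: (le_trans (lerD (AB _) (AB _))).
  rewrite -2!qform_congr MB qform_double_diagJ.
  suff : qform (double_diag y) p <= y j 0 * (\sum_k p k 0 ^+ 2) by move=> h; exact: lerD.
  rewrite qform_double_diag mulr_sumr; apply: ler_sum => k _; rewrite dblE.
  have [jk|kj] := ltnP j (half_ord k); first by rewrite p_supp// expr0n /= !mulr0.
  by rewrite ler_wpM2r ?sqr_ge0 ?yle.
(* Termwise, 2 x_j a_k b_k <= x_k (a_k^2 + b_k^2): for k >= j by x_j <= x_k, and for k < j because
   a_k b_k <= 0. *)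
have lb : x j 0 * (\sum_k p k 0 ^+ 2) *+ 2 <= qform A (M *m a) + qform A (M *m (J *m b)).
  rewrite -2!qform_congr MA qform_double_diagJ !qform_double_diag -big_split /=.
  rewrite -abp mulr_sumr -sumrMnl; apply: ler_sum => k _; rewrite dblE.
  have [kj|jk] := ltnP (half_ord k) j.
    rewrite (ab_supp _ kj); move: (b k 0) => t.
    have := mulr_ge0 (ltW (x0 j)) (sqr_ge0 t).
    by have := mulr_ge0 (ltW (x0 (half_ord k))) (sqr_ge0 t); lra.
  move: (a k 0) (b k 0) => s t; have := mulr_ge0 (ltW (x0 j)) (sqr_ge0 (s - t)).
  have xx : 0 <= x (half_ord k) 0 - x j 0 by rewrite subr_ge0 xle.
  by have := mulr_ge0 xx (addr_ge0 (sqr_ge0 s) (sqr_ge0 t)); lra.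
have pp : 0 < \sum_k p k 0 ^+ 2.
  rewrite lt_neqAle sumr_ge0 ?andbT => [|k _]; last exact: sqr_ge0.
  apply: contra p0; rewrite eq_sym psumr_eq0 => [/allP p0|k _]; last exact: sqr_ge0.
  apply/eqP/matrixP => k l; rewrite (ord1 l) mxE; apply/eqP.
  by rewrite -sqrf_eq0; exact: (implyP (p0 k (mem_index_enum k))).
have := le_trans lb ub; rewrite lerMn2r/= ler_pM2r//.
Qed.

Lemma symplectic_spectrum_uniq A x y : is_symplectic_spectrum A x ->
  is_symplectic_spectrum A y -> x = y.
Proof.
move=> Ax Ay; apply/matrixP => i j; rewrite (ord1 j); apply/eqP; rewrite eq_le.
by rewrite (symplectic_spectrum_mono Ax Ay)// (symplectic_spectrum_mono Ay Ax).
Qed.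

Lemma symplectic_eigenvaluesE A x : is_symplectic_spectrum A x ->
  symplectic_eigenvalues A = x.
Proof.
move=> Ax; rewrite /symplectic_eigenvalues; case: xgetP => [y _ Ay|/(_ x)//].
exact: symplectic_spectrum_uniq Ay Ax.
Qed.

Lemma symplectic_eigenvaluesP A : posdef_mx A ->
  is_symplectic_spectrum A (symplectic_eigenvalues A).
Proof. by move=> /williamson[x Ax]; rewrite (symplectic_eigenvaluesE Ax). Qed.

Lemma symplectic_spectrumZ A x (c : R) : 0 < c -> is_symplectic_spectrum A x ->
  is_symplectic_spectrum (c *: A) (c *: x).
Proof.
move=> c0 [x0 xle [M sM MA]]; split.
- by move=> i; rewrite mxE mulr_gt0.
- by move=> i j ij; rewrite !mxE ler_pM2l// xle.
exists M => //; rewrite -scalemxAr -scalemxAl MA /double_diag scale_block_mx !scaler0.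
suff -> : c *: diag_mx x^T = diag_mx (c *: x)^T by [].
by rewrite linearZ /= linearZ.
Qed.

End Monotone.

(** * Perturbation bounds for forms, symplectic eigenvalues and frames *)

Section Perturbation.
Context {R : realType}.

Lemma qformE {m : nat} (A : 'M[R]_m) v : qform A v = \sum_i \sum_j A j i * (v j 0 * v i 0).
Proof.
rewrite /qform mxE; apply: eq_bigr => i _; rewrite mxE mulr_suml.
by apply: eq_bigr => j _; rewrite mxE; ring.
Qed.

(** [posdef_coord] bounds each |v_i v_j| by a multiple of the form of [A], so an entrywise error
    becomes a relative error of forms. *)
Lemma posdef_perturb {m : nat} (A : 'M[R]_m) : posdef_mx A ->
  exists2 L : R, 0 < L & forall (B : 'M[R]_m) e, (forall i j, `|B i j - A i j| <= e) ->
    forall v, `|qform B v - qform A v| <= e * L * qform A v.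
Proof.
move=> Apd; have [c c0 cA] := posdef_coord Apd.
exists (m%:R * m%:R * c + 1); first by rewrite ltr_wpDl// !mulr_ge0// ltW.
move=> B e Be v; have q0 := qform_ge0 v Apd.
(* In dimension 0 nothing forces 0 <= e, but both forms vanish. *)
case: (posnP m) => [m0|m_gt0].
  by subst m; rewrite !qformE !big_ord0 subrr normr0 mulr0.
have e0 : 0 <= e by apply: le_trans (Be (Ordinal m_gt0) (Ordinal m_gt0)).
rewrite -qformB qformE.
apply: (@le_trans _ _ (\sum_(i < m) \sum_(j < m) e * (c * qform A v))).
  apply: le_trans (ler_norm_sum _ _ _) _; apply: ler_sum => i _.
  apply: le_trans (ler_norm_sum _ _ _) _; apply: ler_sum => j _.
  rewrite normrM ler_pM//; first by rewrite !mxE Be.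
  rewrite normrM; have := cA v i; have := cA v j.
  rewrite -(real_normK (num_real (v i 0))) -(real_normK (num_real (v j 0))).
  by move: `|v i 0| `|v j 0| => s t; have := sqr_ge0 (s - t); lra.
rewrite !sumr_const !card_ord -mulrnA -[_ *+ (m * m)]mulr_natl natrM.
have : 0 <= e * qform A v by rewrite mulr_ge0.
by lra.
Qed.

Context {n : nat}.
Implicit Types (M A B : 'M[R]_(n + n)) (x y : 'cV[R]_n).

Lemma qform_spectrum_col A x M k : M^T *m A *m M = double_diag x ->
  qform A (col k M) = dbl x 0 k.
Proof.
move=> MA; rewrite colE -qform_congr MA qform_double_diag (bigD1 k)//= !mxE eqxx.
rewrite expr1n mulr1 big1 ?addr0// => l lk.
by rewrite !mxE (negPf lk) expr0n /= mulr0.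
Qed.

(** The form of B lies between 1 - hL and 1 + hL times that of [A]; monotonicity and homogeneity
    carry this over to the eigenvalues. Columns of a frame of B have bounded B-form, hence bounded
    [A]-form and bounded entries. *)
Lemma symplectic_eigenvalues_lipschitz A : posdef_mx A ->
  exists L e : R, [/\ 0 < L, 0 < e & forall B h, B \is symmetricmx -> h <= e ->
    (forall i j, `|B i j - A i j| <= h) ->
    [/\ posdef_mx B,
      forall i, `|symplectic_eigenvalues B i 0 - symplectic_eigenvalues A i 0| <= L * h &
      forall M, M^T *m B *m M = double_diag (symplectic_eigenvalues B) ->
        forall i k, `|M i k| <= L]].
Proof.
move=> Apd; have [L L0 LA] := posdef_perturb Apd.
have [c c0 cA] := posdef_coord Apd.
have dA := symplectic_eigenvaluesP Apd.
set a := symplectic_eigenvalues A in dA *; pose s := \sum_i a i 0.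
have a0 : pos_vec a by case: dA.
have as_ i : a i 0 <= s.
  by rewrite /s (bigD1 i)//= lerDl sumr_ge0// => k _; exact/ltW.
have s0 : 0 <= s by rewrite sumr_ge0// => k _; exact/ltW.
have L10 := mulr_ge0 (ltW L0) s0; have L20 := mulr_ge0 (ltW c0) s0.
(* L s serves the eigenvalues and 1 + 4 c s the frame entries; h <= 1 / (2L) gives hL <= 1/2. *)
exists (1 + L * s + c * s *+ 4), (L *+ 2)^-1; split.
- by lra.
- by rewrite invr_gt0 pmulrn_lgt0.
move=> B h Bsym hL Bh.
have [n0|n_gt0] := posnP (n + n)%N.
  have noi (i : 'I_(n + n)) : False by have := ltn_ord i; rewrite {2}n0.
  split; last by move=> M _ i; have := noi i.
    split=> // v v0; suff : v = 0 by move/eqP; rewrite (negPf v0).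
    by apply/matrixP => i; have := noi i.
  by move=> i; have := noi (lshift n i).
have h0 : 0 <= h by apply: le_trans (Bh (Ordinal n_gt0) (Ordinal n_gt0)).
have hL2 : h * L <= 2^-1.
  have -> : 2^-1 = (L *+ 2)^-1 * L by rewrite -[L *+ 2]mulr_natr invfM mulrAC mulVf ?mul1r ?gt_eqF.
  by rewrite ler_pM2r.
have lbB v : (1 - h * L) * qform A v <= qform B v.
  by have := LA B h Bh v; rewrite ler_distl => /andP[]; lra.
have ubB v : qform B v <= (1 + h * L) * qform A v.
  by have := LA B h Bh v; rewrite ler_distl => /andP[]; lra.
have hL0 : 0 <= h * L by rewrite mulr_ge0// ltW.
have Bpd : posdef_mx B.
  split=> // v v0; apply: lt_le_trans (lbB v).
  by rewrite mulr_gt0//; [lra | case: Apd => _; exact].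
have dB := symplectic_eigenvaluesP Bpd.
set b := symplectic_eigenvalues B in dB *.
have qZ (k : R) v : qform (k *: A) v = k * qform A v.
  by rewrite /qform -scalemxAr -scalemxAl mxE.
have lbb i : (1 - h * L) * a i 0 <= b i 0.
  have := symplectic_spectrum_mono (symplectic_spectrumZ (c := 1 - h * L) _ dA) dB _ i.
  by rewrite mxE; apply; [lra|move=> v; rewrite qZ].
have ubb i : b i 0 <= (1 + h * L) * a i 0.
  have := symplectic_spectrum_mono dB (symplectic_spectrumZ (c := 1 + h * L) _ dA) _ i.
  by rewrite mxE; apply; [lra|move=> v; rewrite qZ].
split=> // [i|M MB i k].
  rewrite ler_distl; have := lbb i; have := ubb i; have := as_ i => asi.
  have e1 : h * L * a i 0 <= h * (L * s) by rewrite -mulrA ler_wpM2l// ler_wpM2l// ltW.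
  have e2 : 0 <= h * (c * s) by rewrite mulr_ge0.
  by lra.
have bk : qform B (col k M) <= s *+ 2.
  rewrite (qform_spectrum_col k MB) dblE; apply: le_trans (ubb _) _.
  have := as_ (half_ord k); have := a0 (half_ord k).
  move: (a _ 0) => t t0 ts.
  have : h * L * t <= 2^-1 * t by rewrite ler_wpM2r// ltW.
  by lra.
have := cA (col k M) i; rewrite mxE => Mik.
have qk : qform A (col k M) <= s *+ 4.
  have q0 := qform_ge0 (col k M) Apd; have := lbB (col k M).
  have : (1 - h * L) * qform A (col k M) >= 2^-1 * qform A (col k M) by rewrite ler_wpM2r//; lra.
  by lra.
have : M i k ^+ 2 <= c * s *+ 4 by apply: le_trans Mik _; rewrite -mulrnAr ler_pM2l.
by rewrite -real_normK ?num_real//; move: `|M i k| => t; nra.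
Qed.

End Perturbation.

(** * Traces of powers of JA *)

Section MatrixPowers.
Context {R : realType}.

Definition mxpow {m : nat} (Z : 'M[R]_m) k : 'M[R]_m := iter k (mulmx Z) 1%:M.

Lemma mxpowS {m : nat} (Z : 'M[R]_m) k : mxpow Z k.+1 = Z *m mxpow Z k.
Proof. by []. Qed.

Lemma mxpowSr {m : nat} (Z : 'M[R]_m) k : mxpow Z k.+1 = mxpow Z k *m Z.
Proof. by elim: k => [|k IH]; [rewrite /mxpow /= mulmx1 mul1mx|rewrite mxpowS {1}IH mulmxA]. Qed.

Lemma cvg_mxpow {m : nat} {T : Type} (F : set_system T) {FF : Filter F}
    (f : T -> 'M[R]_m) (a : 'M[R]_m) k :
  f y @[y --> F] --> a -> mxpow (f y) k @[y --> F] --> mxpow a k.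
Proof. by move=> fa; elim: k => [|k IH]; [exact: cvg_cst|exact: cvg_mulmx]. Qed.

(** D is the derivative of the k-th power at Z in direction E. Cyclicity of the trace merges its k
    terms; the extra power j makes the induction go through, and at k = 0 the factor k annihilates
    the truncated exponent. *)
Lemma mxpow_expand {m : nat} (Z E : 'M[R]_m) k : exists D : 'M[R]_m, exists r : R -> 'M[R]_m,
  [/\ forall t, mxpow (Z + t *: E) k = mxpow Z k + t *: D + t ^+ 2 *: r t,
      r t @[t --> 0] --> r 0 &
      forall j, \tr (mxpow Z j *m D) = k%:R * \tr (mxpow Z (j + k).-1 *m E)].
Proof.
elim: k => [|k [D [r [ZE r0 trD]]]].
  exists 0, (fun=> 0); split=> [t||j]; first by rewrite !scaler0 !addr0.
    exact: cvg_cst.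
  by rewrite mulmx0 linear0 mul0r.
exists (E *m mxpow Z k + Z *m D), (fun t => E *m D + Z *m r t + t *: (E *m r t)); split=> [t||j].
- rewrite mxpowS ZE !mulmxDl !mulmxDr -!scalemxAr -!scalemxAl -mxpowS.
  by apply/matrixP => a b; rewrite !mxE; ring.
- apply: cvgD; first by apply: cvgD; [exact: cvg_cst|apply: cvg_mulmx => //; exact: cvg_cst].
  by apply: cvgZ; [exact: cvg_id|apply: cvg_mulmx => //; exact: cvg_cst].
rewrite mulmxDr linearD /= !mulmxA -mxpowSr trD addSn /= addnS /= -mulmxA.
rewrite [in X in X + _]mxtrace_mulC -mulmxA.
have -> : mxpow Z k *m mxpow Z j = mxpow Z (j + k).
  by rewrite addnC; elim: k {ZE r0 trD} => [|k IH]; rewrite ?mul1mx// addSn !mxpowS -mulmxA IH.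
by rewrite mxtrace_mulC -natr1; ring.
Qed.

(** Each induction step multiplies the error by x + h, which |h| <= 1 bounds by |x| + 1. *)
Lemma pow_expand (x : R) k : exists2 C : R, 0 <= C & forall h, `|h| <= 1 ->
  `|(x + h) ^+ k.+1 - x ^+ k.+1 - k.+1%:R * x ^+ k * h| <= C * h ^+ 2.
Proof.
elim: k => [|k [C C0 IH]].
  exists 0 => // h _; rewrite mul0r !expr1 expr0 mulr1.
  have -> : x + h - x - 1%:R * h = 0 by ring.
  by rewrite normr0.
exists (k.+1%:R * `|x| ^+ k + (`|x| + 1) * C) => [|h h1].
  by rewrite addr_ge0 ?mulr_ge0 ?exprn_ge0// addr_ge0.
have -> : (x + h) ^+ k.+2 - x ^+ k.+2 - k.+2%:R * x ^+ k.+1 * h =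
   k.+1%:R * x ^+ k * h ^+ 2 + (x + h) * ((x + h) ^+ k.+1 - x ^+ k.+1 - k.+1%:R * x ^+ k * h).
  by rewrite -[k.+2%:R]natr1 ![_ ^+ k.+2]exprS; rewrite [x ^+ k.+1]exprS; ring.
apply: le_trans (ler_normD _ _) _; rewrite [leRHS]mulrDl; apply: lerD.
  by rewrite 2!normrM normr_nat [`|h ^+ 2|]ger0_norm ?sqr_ge0 ?normrX.
rewrite normrM -[leRHS]mulrA ler_pM// ?IH//.
by apply: le_trans (ler_normD _ _) _; rewrite lerD2l.
Qed.

End MatrixPowers.

Section Interpolation.
Context {F : fieldType}.

(** Newton's scheme: the value at a new node is corrected by a multiple of the polynomial vanishing
    at the other nodes. *)
Lemma interpolation (s : seq F) (v : F -> F) : uniq s ->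
  exists p : {poly F}, forall x, x \in s -> p.[x] = v x.
Proof.
elim: s => [|a s IH] /=; first by exists 0.
move=> /andP[as_ /IH[p ps]].
pose q := \prod_(b <- s) ('X - b%:P).
have qs x : (q.[x] == 0) = (x \in s) by rewrite -/(root q x) root_prod_XsubC.
exists (p + ((v a - p.[a]) / q.[a]) *: q) => x; rewrite inE => /orP[/eqP->|xs].
  by rewrite hornerD hornerZ divfK ?qs// addrC subrK.
rewrite hornerD hornerZ ps//; have := qs x; rewrite xs => /eqP ->.
by rewrite mulr0 addr0.
Qed.

End Interpolation.

(** * Even power sums of symplectic eigenvalues as traces, and their gradients *)

Section Traces.
Context {R : realType} {n : nat}.
Implicit Types (M A B H : 'M[R]_(n + n)) (x y g : 'cV[R]_n).
Local Notation J := (@Jmx R n).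

Lemma mxpow_conj {m : nat} (P D Z : 'M[R]_m) k : P \in unitmx -> Z *m P = P *m D ->
  mxpow Z k *m P = P *m mxpow D k.
Proof.
move=> uP ZP; elim: k => [|k IH]; first by rewrite /mxpow /= mul1mx mulmx1.
by rewrite mxpowS -mulmxA IH mulmxA ZP -mulmxA.
Qed.

(** Since M J M^T = J, the congruence of A by M is a similarity of J A. *)
Lemma symplectic_conj A x M : symplectic_mx M -> M^T *m A *m M = double_diag x ->
  (J *m A) *m M = M *m (J *m double_diag x).
Proof.
move=> sM <-; rewrite !mulmxA; congr (_ *m _); congr (_ *m _).
by rewrite symplectic_tr.
Qed.

Definition cmap (h : R -> R) x : 'cV[R]_n := map_mx h x.

Lemma double_diagM x y : double_diag x *m double_diag y = double_diag (\col_i (x i 0 * y i 0)).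
Proof.
rewrite /double_diag mulmx_block !mul0mx !mulmx0 !add0r !addr0.
suff -> : diag_mx x^T *m diag_mx y^T = diag_mx (\col_i (x i 0 * y i 0))^T by [].
by rewrite mulmx_diag; congr diag_mx; apply/rowP => i; rewrite !mxE.
Qed.

(** J commutes with [double_diag x] and J^2 = -1, so the square of the product is minus the square
    of the diagonal. *)
Lemma mxpow_JD_even x k : mxpow (J *m double_diag x) k.*2 =
  (-1) ^+ k *: double_diag (cmap (fun t => t ^+ k.*2) x).
Proof.
elim: k => [|k IH].
  rewrite expr0 scale1r /double_diag /=.
  have -> : cmap (fun t => t ^+ 0.*2) x = const_mx 1 by apply/matrixP => i j; rewrite !mxE.
  by rewrite trmx_const diag_const_mx -scalar_mx_block.
rewrite doubleS !mxpowS IH -!scalemxAr mulmxA -[J *m _ *m (J *m _)]mulmxA.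
rewrite [double_diag x *m (J *m _)]mulmxA -double_diagJ !mulmxA mul_Jmx !mulNmx mul1mx.
rewrite exprS mulN1r scaleNr scalerN.
congr (- (_ *: _)); rewrite !double_diagM; congr double_diag.
by apply/matrixP => i j; rewrite !mxE (ord1 j) !exprS mulrA.
Qed.

Lemma trace_even A x M k : symplectic_mx M -> M^T *m A *m M = double_diag x ->
  \tr (mxpow (J *m A) k.*2) = (-1) ^+ k * (\sum_i x i 0 ^+ k.*2) *+ 2.
Proof.
move=> sM MA; have uM := symplectic_unitmx sM.
have E := mxpow_conj k.*2 uM (symplectic_conj sM MA).
rewrite -[mxpow (J *m A) _](mulmxK uM) E mxtrace_mulC mulmxA mulVmx// mul1mx.
rewrite mxpow_JD_even linearZ /= /double_diag mxtrace_block !mxtrace_diag.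
rewrite -mulr2n mulrnAr; congr (_ * _ *+ _); apply: eq_bigr => i _.
by rewrite !mxE.
Qed.

(* For M^T A M = D_d(A) and g = grad f(d(A)) this is the gradient of f o d at A. *)
Definition frame_grad M g := 2^-1 *: (M *m double_diag g *m M^T).

(** The right-hand side is a polynomial in [A] alone, so for odd powers the result is independent of
    the frame and continuous in [A]. *)
Lemma frame_grad_pow A x M k : symplectic_mx M -> M^T *m A *m M = double_diag x ->
  frame_grad M (cmap (fun t => t ^+ k.*2.+1) x) =
  (2^-1 * (-1) ^+ k.+1) *: (mxpow (J *m A) k.*2.+1 *m J).
Proof.
move=> sM MA; have uM := symplectic_unitmx sM.
have MT : M^T = J^T *m invmx M *m J.
  rewrite symplectic_invmx// tr_Jmx !mulNmx !mulmxN !mulNmx opprK !mulmxA mul_Jmx !mulNmx mul1mx.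
  by rewrite -mulmxA mul_Jmx mulmxN mulmx1 opprK.
rewrite /frame_grad -scalerA; congr (_ *: _); rewrite MT.
have E := mxpow_conj k.*2.+1 uM (symplectic_conj sM MA).
rewrite -[mxpow (J *m A) _](mulmxK uM) E mxpowS mxpow_JD_even tr_Jmx.
rewrite !(mulNmx, mulmxN, mulmxA).
rewrite -[M *m double_diag _ *m J]mulmxA -double_diagJ.
have sg : (-1) ^+ k.+1 * (-1) ^+ k = -1 :> R.
  by rewrite exprS mulN1r mulNr -expr2 sqrr_sign.
rewrite -!scalemxAr -!scalemxAl scalerA sg scaleN1r.
congr (- (_ *m _ *m _)); rewrite -!mulmxA; congr (_ *m (_ *m _)); rewrite double_diagM.
by congr double_diag; apply/matrixP => i j; rewrite !mxE (ord1 j) exprS.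
Qed.

(* Only odd powers of the symplectic eigenvalues occur as derivatives of the traces
   of powers of JB; they suffice to interpolate g because the d_i are positive. *)
Lemma odd_interpolation x g : pos_vec x ->
  (forall i j, x i 0 = x j 0 -> g i 0 = g j 0) ->
  exists p : {poly R}, forall i,
    g i 0 = \sum_(k < size p) p`_k * x i 0 ^+ k.*2.+1.
Proof.
move=> x0 gx.
(* The interpolated values are g_i / x_i at the nodes x_i^2; they are well defined because g is
   constant where x is. Multiplying by x_i yields the odd powers. *)
pose v (t : R) := if [pick i | x i 0 ^+ 2 == t] is Some i then g i 0 / x i 0 else 0.
have [p ps] := interpolation v (undup_uniq [seq x i 0 ^+ 2 | i : 'I_n]).
exists p => i.
have xs : x i 0 ^+ 2 \in [seq x i 0 ^+ 2 | i : 'I_n].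
  by apply/mapP; exists i; rewrite ?mem_enum.
have := ps (x i 0 ^+ 2); rewrite mem_undup => /(_ xs).
rewrite /v; case: pickP => [j|/(_ i)]; last by rewrite eqxx.
rewrite eqrXn2 ?ltW// => /eqP ji; rewrite (gx j i ji) ji horner_coef => E.
rewrite -[LHS](divfK (lt0r_neq0 (x0 i))) -E mulr_suml; apply: eq_bigr => k _.
by rewrite -exprM mul2n -mulrA -exprSr.
Qed.

Lemma double_diagZ (c : R) x : double_diag (c *: x) = c *: double_diag x.
Proof.
rewrite /double_diag scale_block_mx !scaler0.
suff -> : diag_mx (c *: x)^T = c *: diag_mx x^T by [].
by rewrite linearZ /= linearZ.
Qed.

Lemma double_diagD x y : double_diag (x + y) = double_diag x + double_diag y.
Proof. by rewrite /double_diag add_block_mx !addr0 linearD /= linearD. Qed.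

Lemma double_diag_sum (I : finType) (c : I -> R) (h : I -> 'cV[R]_n) :
  double_diag (\sum_i c i *: h i) = \sum_i c i *: double_diag (h i).
Proof.
apply: (big_ind2 (fun a b => double_diag a = b)) => [|a b a' b' <- <-|i _].
- by rewrite /double_diag trmx0 linear0 block_mx0.
- exact: double_diagD.
- exact: double_diagZ.
Qed.

Lemma frame_gradE M (I : finType) (c : I -> R) (h : I -> 'cV[R]_n) :
  frame_grad M (\sum_i c i *: h i) = \sum_i c i *: frame_grad M (h i).
Proof.
rewrite /frame_grad double_diag_sum mulmx_sumr mulmx_suml scaler_sumr.
apply: eq_bigr => i _.
by rewrite -scalemxAr -scalemxAl !scalerA mulrC.
Qed.

Lemma frame_grad_sym M g : frame_grad M g \is symmetricmx.
Proof.
apply/symmetricmxP; rewrite /frame_grad linearZ /= !trmx_mul trmxK.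
by rewrite double_diag_tr mulmxA.
Qed.

End Traces.

Section Limits.
Context {R : realType}.

Lemma cvgr_near_dist {T : Type} (F : set_system T) {FF : Filter F} (f g e : T -> R) (l : R) :
  (\forall t \near F, `|f t - g t| <= e t) -> e t @[t --> F] --> 0 ->
  g t @[t --> F] --> l -> f t @[t --> F] --> l.
Proof.
move=> fge e0 gl.
apply: (squeeze_cvgr (f := fun t => g t - e t) (h := fun t => g t + e t)).
- by apply: filterS fge => t; rewrite ler_distl.
- by rewrite -[l]subr0; exact: cvgB.
- by rewrite -[l]addr0; exact: cvgD.
Qed.

Lemma mx_entry_le_norm {p q : nat} (M : 'M[R]_(p, q)) i j : `|M i j| <= `|M|.
Proof. by rewrite [leRHS]/Num.norm /= mx_normrE; apply/bigmax_geP; right; exists (i, j). Qed.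

Lemma cvg_right0 (T : topologicalType) (f : R -> T) (l : T) :
  f t @[t --> 0] --> l -> f t @[t --> 0^'+] --> l.
Proof. by move=> fl; apply: cvg_trans fl; apply: cvg_app; exact: cvg_within. Qed.

Lemma near_right0 (e : R) : 0 < e -> \forall t \near 0^'+, 0 < t /\ t <= e.
Proof.
move=> e0; near=> t; split; first by near: t; exact: nbhs_right_gt.
by near: t; exact: nbhs_right_le.
Unshelve. all: by end_near. Qed.

End Limits.

(** * Directional derivatives of weighted sums of symplectic eigenvalues *)

Section EigenvalueDerivative.
Context {R : realType} {n : nat}.
Implicit Types (M A B H : 'M[R]_(n + n)) (x y g : 'cV[R]_n).
Local Notation J := (@Jmx R n).
Local Notation d := symplectic_eigenvalues.

Lemma symplectic_eigenvalues_rate A H : posdef_mx A -> H \is symmetricmx ->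
  exists2 W : R, 0 <= W & \forall t \near 0^'+,
    posdef_mx (A + t *: H) /\ forall i, `|d (A + t *: H) i 0 - d A i 0| <= W * t.
Proof.
move=> Apd /symmetricmxP HT; have [L [e [L0 e0 LA]]] := symplectic_eigenvalues_lipschitz Apd.
have [/symmetricmxP AT _] := Apd.
exists (L * (1 + `|H|)); first by rewrite mulr_ge0 ?addr_ge0// ltW.
have k0 : 0 < 1 + `|H| by rewrite ltr_wpDr.
near=> t; have [t0 te] : 0 < t /\ t <= e / (1 + `|H|).
  by near: t; apply: near_right0; rewrite divr_gt0.
have [||i j|Bpd Bd _] := LA (A + t *: H) (t * (1 + `|H|)).
- by apply/symmetricmxP; rewrite linearD linearZ /= AT HT.
- by rewrite -ler_pdivlMr.
- rewrite !mxE [A i j + _]addrC addrK normrM gtr0_norm// ler_pM2l//.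
  by rewrite (le_trans (mx_entry_le_norm H i j))// lerDr.
by split=> // i; rewrite -mulrA [_ * t]mulrC.
Unshelve. all: by end_near. Qed.

(** The power sum of exponent 2k+2 is a trace, whose derivative [mxpow_expand] gives. Its Taylor
    expansion in the eigenvalues has error O(t^2) by the Lipschitz bound, so no differentiability of
    a single eigenvalue enters. *)
Lemma eigen_power_deriv A H M k : posdef_mx A -> H \is symmetricmx ->
  symplectic_mx M -> M^T *m A *m M = double_diag (d A) ->
  \sum_i d A i 0 ^+ k.*2.+1 * ((d (A + t *: H) i 0 - d A i 0) / t) @[t --> 0^'+] -->
  frob_dot (frame_grad M (cmap (fun s => s ^+ k.*2.+1) (d A))) H.
Proof.
move=> Apd Hsym sM MA; have [W W0 HW] := symplectic_eigenvalues_rate Apd Hsym.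
set a := d A in MA HW *.
have [D [r [ZE r0 trD]]] := mxpow_expand (J *m A) (J *m H) k.+1.*2.
have [C C0 aC] : exists2 C : R, 0 <= C & forall i h, `|h| <= 1 ->
    `|(a i 0 + h) ^+ k.+1.*2 - a i 0 ^+ k.+1.*2 - k.+1.*2%:R * a i 0 ^+ k.*2.+1 * h| <= C * h ^+ 2.
  have [C C0 aC] := all_sig2 (fun i => cid2 (pow_expand (a i 0) k.*2.+1)).
  exists (\sum_i C i) => [|i h h1]; first exact: sumr_ge0.
  apply: le_trans (aC i h h1) _; rewrite ler_wpM2r ?sqr_ge0// (bigD1 i)//= lerDl.
  exact: sumr_ge0.
pose m : R := k.+1.*2%:R; have m0 : 0 < m by rewrite ltr0n.
pose s : R := 2^-1 * (-1) ^+ k.+1.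
(* s turns the trace into the power sum, so g is the difference quotient of the power sum divided by
   its exponent m. *)
pose g t := m^-1 * (s * (\tr D + t * \tr (r t))).
apply: (@cvgr_near_dist _ _ _ _ _ g (fun t => m^-1 * (n%:R * C * W ^+ 2 * t))).
- near=> t; have [t0 t1] : 0 < t /\ t <= (1 + W)^-1.
    by near: t; apply: near_right0; rewrite invr_gt0 ltr_wpDr.
  have [Bpd Wt] : posdef_mx (A + t *: H) /\ forall i, `|d (A + t *: H) i 0 - a i 0| <= W * t.
    by near: t.
  have Wt1 : W * t <= 1.
    have : (1 + W) * t <= 1 by rewrite mulrC -ler_pdivlMr ?mul1r ?ltr_wpDr.
    by have := mulr_ge0 W0 (ltW t0); lra.
  set b := d (A + t *: H) in Wt *.
  have [_ _ [N sN NB]] := symplectic_eigenvaluesP Bpd.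
  have trA := trace_even k.+1 sM MA; have trB := trace_even k.+1 sN NB.
  have sg : (-1) ^+ k.+1 * (-1) ^+ k.+1 = 1 :> R by rewrite -expr2 sqrr_sign.
  have Eg : t * (m * g t) = \sum_i (b i 0 ^+ k.+1.*2 - a i 0 ^+ k.+1.*2).
    rewrite /g mulVKf ?gt_eqF// sumrB.
    have : \tr (mxpow (J *m (A + t *: H)) k.+1.*2) =
        \tr (mxpow (J *m A) k.+1.*2) + t * \tr D + t ^+ 2 * \tr (r t).
      by rewrite mulmxDr -scalemxAr ZE !linearD /= !linearZ.
    rewrite trA trB -/b.
    move: (\sum_i a i 0 ^+ _) => v; move: (\sum_i b i 0 ^+ _) => u uv.
    have : t * (\tr D + t * \tr (r t)) = (-1) ^+ k.+1 * (u - v) *+ 2.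
      by rewrite mulrBr mulrnBl uv; ring.
    rewrite mulrCA => ->; rewrite /s.
    by transitivity (((-1) ^+ k.+1 * (-1) ^+ k.+1) * (u - v)); [field|rewrite sg mul1r].
  rewrite -(ler_pM2l m0) mulVKf ?gt_eqF// -(ler_pM2l t0).
  rewrite -{1}(gtr0_norm m0) -{1}(gtr0_norm t0) -!normrM.
  have -> : t * (m * (\sum_i a i 0 ^+ k.*2.+1 * ((b i 0 - a i 0) / t) - g t)) =
    - \sum_i (b i 0 ^+ k.+1.*2 - a i 0 ^+ k.+1.*2 - m * a i 0 ^+ k.*2.+1 * (b i 0 - a i 0)).
    rewrite !mulrBr Eg [in RHS]sumrB opprB; congr (_ - _).
    rewrite !mulr_sumr; apply: eq_bigr => i _; field; exact: lt0r_neq0.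
  rewrite normrN; apply: le_trans (ler_norm_sum _ _ _) _.
  apply: (@le_trans _ _ (\sum_(i < n) C * (W * t) ^+ 2)); last first.
    by rewrite sumr_const card_ord -mulr_natl le_eqVlt; apply/orP; left; apply/eqP; ring.
  apply: ler_sum => i _.
  have -> : b i 0 ^+ k.+1.*2 = (a i 0 + (b i 0 - a i 0)) ^+ k.+1.*2 by rewrite addrC subrK.
  apply: le_trans (aC i _ (le_trans (Wt i) Wt1)) _.
  by rewrite ler_wpM2l// -real_normK ?num_real// lerXn2r ?nnegrE ?mulr_ge0// ltW.
- apply: cvg_right0.
  have : m^-1 * (n%:R * C * W ^+ 2 * t) @[t --> 0] --> m^-1 * (n%:R * C * W ^+ 2 * 0).
    apply: cvgM; first exact: cvg_cst.
    by apply: cvgM; [exact: cvg_cst|exact: cvg_id].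
  by rewrite !mulr0.
- apply: cvg_right0.
  have -> : frob_dot (frame_grad M (cmap (fun s => s ^+ k.*2.+1) a)) H =
      m^-1 * (s * (\tr D + 0 * \tr (r 0))).
    (* The case j = 0 of [trD] gives tr D = m tr((JA)^(2k+1) J H), matching [frame_grad_pow]. *)
    rewrite mul0r addr0 -[D]mul1mx (trD 0) add0n doubleS /=.
    rewrite /frob_dot (symmetricmxP _ (frame_grad_sym _ _)) (frame_grad_pow k sM MA).
    rewrite -scalemxAl linearZ /= -mulmxA -/s mulrCA mulKf//.
    exact: lt0r_neq0.
  apply: cvgM; first exact: cvg_cst.
  apply: cvgM; first exact: cvg_cst.
  apply: cvgD; first exact: cvg_cst.
  by apply: cvgM; [exact: cvg_id|exact: cvg_mxtrace].
Unshelve. all: by end_near. Qed.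

Lemma frob_dot_suml {p q : nat} (I : finType) (c : I -> R) (G : I -> 'M[R]_(p, q)) U :
  frob_dot (\sum_i c i *: G i) U = \sum_i c i * frob_dot (G i) U.
Proof.
rewrite /frob_dot linear_sum /= mulmx_suml linear_sum /=; apply: eq_bigr => i _.
have -> : (c i *: G i)^T = c i *: (G i)^T by rewrite linearZ.
by rewrite -scalemxAl linearZ.
Qed.

(** Weights that agree on equal eigenvalues are combinations of odd powers of them, so the limit is
    a combination of those for powers. *)
Lemma eigen_weighted_deriv A H M g : posdef_mx A -> H \is symmetricmx ->
  symplectic_mx M -> M^T *m A *m M = double_diag (d A) ->
  (forall i j, d A i 0 = d A j 0 -> g i 0 = g j 0) ->
  \sum_i g i 0 * ((d (A + t *: H) i 0 - d A i 0) / t) @[t --> 0^'+] -->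
  frob_dot (frame_grad M g) H.
Proof.
move=> Apd Hsym sM MA gd; have [a0 _ _] := symplectic_eigenvaluesP Apd.
have [p gp] := odd_interpolation a0 gd.
have -> : g = \sum_(k < size p) p`_k *: cmap (fun s => s ^+ k.*2.+1) (d A).
  apply/matrixP => i j; rewrite (ord1 j) gp summxE; apply: eq_bigr => k _.
  by rewrite !mxE.
rewrite frame_gradE frob_dot_suml.
have E t : \sum_i (\sum_(k < size p) p`_k *: cmap (fun s => s ^+ k.*2.+1) (d A)) i 0 *
      ((d (A + t *: H) i 0 - d A i 0) / t) =
    \sum_(k < size p) p`_k * \sum_i d A i 0 ^+ k.*2.+1 * ((d (A + t *: H) i 0 - d A i 0) / t).
  under [RHS]eq_bigr do rewrite mulr_sumr.
  rewrite [RHS]exchange_big; apply: eq_bigr => i _; rewrite summxE mulr_suml.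
  by apply: eq_bigr => k _; rewrite !mxE -mulrA.
under eq_fun do rewrite E.
apply: cvg_big => [|k _]; first exact: add_continuous.
by apply: cvgM; [exact: cvg_cst|exact: eigen_power_deriv].
Qed.

End EigenvalueDerivative.

(** * Locally Lipschitz functions with a gradient *)

Section Gradients.
Context {R : realType}.

Lemma frob_dotE {p q : nat} (g u : 'M[R]_(p, q)) :
  frob_dot g u = \sum_i \sum_j g j i * u j i.
Proof.
rewrite /frob_dot /mxtrace; apply: eq_bigr => i _; rewrite mxE.
by apply: eq_bigr => j _; rewrite mxE.
Qed.

Context {n : nat}.
Implicit Types (x y z g u : 'cV[R]_n) (f : 'cV[R]_n -> R).

Lemma frob_dot_cV g u : frob_dot g u = \sum_i g i 0 * u i 0.
Proof. by rewrite frob_dotE big_ord_recl big_ord0 addr0. Qed.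

Lemma frob_dotN g u : frob_dot g (- u) = - frob_dot g u.
Proof. by rewrite /frob_dot mulmxN linearN. Qed.

Lemma frob_dotB g u z : frob_dot g (u - z) = frob_dot g u - frob_dot g z.
Proof. by rewrite /frob_dot mulmxBr linearB. Qed.

Lemma frob_dot_le g u : `|frob_dot g u| <= n%:R * `|g| * `|u|.
Proof.
rewrite frob_dot_cV; apply: le_trans (ler_norm_sum _ _ _) _.
apply: (@le_trans _ _ (\sum_(i < n) `|g| * `|u|)).
  by apply: ler_sum => i _; rewrite normrM ler_pM// mx_entry_le_norm.
by rewrite sumr_const card_ord -[_ *+ n]mulr_natl mulrA.
Qed.

(** The one-sided limits along u and -u combine into a two-sided derivative. *)
Lemma gradient_is_derive f y u (s : R) g : is_gradient [set: 'cV[R]_n] f (y + s *: u) g ->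
  is_derive s 1 (fun r => f (y + r *: u)) (frob_dot g u).
Proof.
move=> [_ fg].
suff : h^-1 *: (((fun r => f (y + r *: u)) \o shift s) (h *: (1:R)) - f (y + s *: u)) @[h --> 0^']
    --> frob_dot g u.
  by move=> h; apply: DeriveDef; [apply/cvg_ex; exists (frob_dot g u)|exact: cvg_lim].
have E (h : R) v : y + (h + s) *: v = y + s *: v + h *: v by rewrite scalerDl addrAC addrA.
apply: (@cvg_at_right_left_dnbhs _ R^o).
  apply: cvg_trans (fg u I); apply: near_eq_cvg; apply: nearW => h /=.
  by rewrite /GRing.scale /= mulr1 E mulrC.
apply/cvg_at_leftNP; rewrite oppr0 -[frob_dot g u]opprK -frob_dotN.
apply: cvg_trans (cvgN (fg (- u) I)); apply: near_eq_cvg; apply: nearW => h /=.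
rewrite /GRing.scale /= mulr1 E invrN mulNr mulrC; congr (- (_ * _)).
change (f (y + s *: u + h *: (- u)) - f (y + s *: u) = f (y + s *: u + - h *: u) - f (y + s *: u)).
by rewrite scalerN scaleNr.
Qed.

Lemma gradient_lipschitz f x (G : 'cV[R]_n -> 'cV[R]_n) :
  (\forall y \near x, is_gradient [set: 'cV[R]_n] f y (G y)) ->
  G y @[y --> x] --> G x ->
  exists L e : R, [/\ 0 <= L, 0 < e & forall y z, `|y - x| < e -> `|z - x| < e ->
    `|f z - f y| <= L * `|z - y|].
Proof.
move=> fG Gx; have G1 : \forall y \near x, `|G y - G x| <= 1 by move/cvgrPdistC_le: Gx; apply.
have [e /= e0 He] := proj1 (nbhs_normP x _) (filterI fG G1).
exists (n%:R * (1 + `|G x|)), e; split=> // y z yx zx.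
have seg (s : R) : 0 <= s -> s <= 1 -> `|y + s *: (z - y) - x| < e.
  move=> s0 s1; have -> : y + s *: (z - y) - x = (1 - s) *: (y - x) + s *: (z - x).
    by apply/matrixP => i j; rewrite !mxE; ring.
  apply: le_lt_trans (ler_normD _ _) _; rewrite !normrZ ger0_norm ?subr_ge0// ger0_norm//.
  have [->|sn0] := eqVneq s 0; first by rewrite subr0 mul1r mul0r addr0.
  have sp : 0 < s by rewrite lt_neqAle eq_sym sn0.
  have : s * `|z - x| < s * e by rewrite ltr_pM2l.
  have : (1 - s) * `|y - x| <= (1 - s) * e by rewrite ler_wpM2l ?subr_ge0// ltW.
  by lra.
have drv (s : R) : 0 <= s -> s <= 1 ->
    is_derive s 1 (fun r : R => f (y + r *: (z - y))) (frob_dot (G (y + s *: (z - y))) (z - y)).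
  move=> s0 s1; apply: gradient_is_derive.
  by have [] // := He (y + s *: (z - y)); rewrite /= distrC seg.
have [||c c01] := @MVT_segment R (fun r => f (y + r *: (z - y)))
    (fun s => frob_dot (G (y + s *: (z - y))) (z - y)) 0 1 ler01.
- by move=> s; rewrite in_itv /= => /andP[s0 s1]; apply: drv; exact: ltW.
- apply: derivable_within_continuous => s; rewrite in_itv /= => /andP[s0 s1].
  by have [] := drv s s0 s1.
rewrite scale1r scale0r addr0 [y + (z - y)]addrC subrK subr0 mulr1 => ->.
move: c01; rewrite in_itv /= => /andP[c0 c1].
apply: le_trans (frob_dot_le _ _) _; rewrite ler_wpM2r// ler_wpM2l//.
have [] := He (y + c *: (z - y)); first by rewrite /= distrC seg.
by move=> _ /= h; rewrite -[G (y + _)](subrK (G x)) (le_trans (ler_normD _ _))// lerD2r.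
Qed.

Lemma compact_box (W : R) : compact [set u : 'cV[R]_n | forall i, `|u i 0| <= W].
Proof.
have -> : [set u : 'cV[R]_n | forall i, `|u i 0| <= W] =
    trmx @` [set v : 'rV[R]_n | forall i, v 0 i \in `[- W, W]].
  apply/seteqP; split=> [u uW|_ [v vW <-] i].
    by exists u^T; [move=> i; rewrite in_itv /= mxE -ler_norml|rewrite trmxK].
  by have := vW i; rewrite in_itv /= mxE -ler_norml.
apply: continuous_compact.
  by apply: continuous_subspaceT => v; apply: (cvg_trmx (F := nbhs v)); exact: cvg_id.
by apply: (rV_compact (A := fun=> `[- W, W]%classic)) => _; exact: segment_compact.
Qed.

(* The direction w t need not converge; compactness of a box of directions makes the
   directional limits uniform. *)
Lemma gradient_bounded_direction f y g (L e W : R) (w : R -> 'cV[R]_n) :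
  is_gradient [set: 'cV[R]_n] f y g -> 0 <= L -> 0 < e ->
  (forall z z', `|z - y| < e -> `|z' - y| < e -> `|f z' - f z| <= L * `|z' - z|) ->
  (\forall t \near 0^'+, forall i, `|w t i 0| <= W) ->
  (f (y + t *: w t) - f y) / t - frob_dot g (w t) @[t --> 0^'+] --> 0.
Proof.
move=> [_ fg] L0 e0 fL wW; apply/cvgr0Pnorm_le => eps eps0.
have /compact_near_coveringP/(_ R 0^'+ (fun t u =>
  `|(f (y + t *: u) - f y) / t - frob_dot g u| <= eps)) := @compact_box W.
move=> /(_ _ _) cov.
have {}cov : \forall t \near 0^'+, [set u : 'cV[R]_n | forall i, `|u i 0| <= W] `<=`
    (fun u => `|(f (y + t *: u) - f y) / t - frob_dot g u| <= eps).
  apply: cov => u0 _.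
  (* k bounds how fast the error varies with the direction: L from f, n |g| from the linear term,
     and 1 for positivity. *)
  pose k := L + n%:R * `|g| + 1.
  have k0 : 0 < k by rewrite ltr_wpDl// addr_ge0// mulr_ge0.
  pose eta := Num.min 1 (eps / 2 / k).
  have eta0 : 0 < eta by rewrite lt_min ltr01 !divr_gt0.
  have e2 : 0 < eps / 2 by rewrite divr_gt0.
  have e3 : 0 < e / (2 + `|u0|) by rewrite divr_gt0// ltr_wpDr.
  (* The bound on t keeps y + t u in the Lipschitz ball for all u within 1 of u0. *)
  exists ([set u | `|u - u0| < eta],
    [set t | (0 < t /\ t <= e / (2 + `|u0|)) /\
      `|(f (y + t *: u0) - f y) / t - frob_dot g u0| <= eps / 2]).
    split=> /=.
      by apply: (proj2 (nbhs_normP u0 _)); exists eta => // u /=; rewrite distrC.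
    by apply: filterI; [exact: near_right0|exact: (proj1 (cvgrPdistC_le _ _) (fg u0 I) _ e2)].
  move=> [u t] /= [uu0 [[t0 te] tu0]].
  have u1 : `|u - u0| < 1 by move: uu0; rewrite lt_min => /andP[].
  have u2 : k * `|u - u0| <= eps / 2.
    move: uu0; rewrite lt_min => /andP[_ /ltW].
    by rewrite ler_pdivlMr// mulrC.
  have inb v : `|v| < 2 + `|u0| -> `|y + t *: v - y| < e.
    move=> v2; rewrite addrC addKr normrZ gtr0_norm//.
    by move: te; rewrite ler_pdivlMr ?ltr_wpDr//; apply: lt_le_trans; rewrite ltr_pM2l.
  have fuu0 : `|f (y + t *: u) - f (y + t *: u0)| <= L * (t * `|u - u0|).
    have := fL (y + t *: u0) (y + t *: u).
    have -> : y + t *: u - (y + t *: u0) = t *: (u - u0).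
      by apply/matrixP => i j; rewrite !mxE; ring.
    rewrite normrZ gtr0_norm//; apply; apply: inb; first by rewrite ltrDr.
    rewrite -[u](subrK u0); apply: le_lt_trans (ler_normD _ _) _.
    by rewrite ltrD2r (lt_trans u1)// ltr1n.
  have -> : (f (y + t *: u) - f y) / t - frob_dot g u =
     (f (y + t *: u) - f (y + t *: u0)) / t + ((f (y + t *: u0) - f y) / t - frob_dot g u0)
     - frob_dot g (u - u0).
    by rewrite frob_dotB; ring.
  apply: le_trans (ler_normB _ _) _; apply: le_trans (lerD (ler_normD _ _) (frob_dot_le _ _)) _.
  have : `|(f (y + t *: u) - f (y + t *: u0)) / t| <= L * `|u - u0|.
    by rewrite normrM normfV (gtr0_norm t0) ler_pdivrMr// -mulrA [`|_| * t]mulrC.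
  have := normr_ge0 (u - u0); move: u2 tu0; rewrite /k.
  move: `|u - u0| `|_ / t| `|_ / t - _| => r a b u2 b2 r0 aL.
  lra.
apply: filterS2 wW cov => t wt /(_ (w t)); exact.
Qed.

(** The transposition of i and j fixes x and exchanges the basis directions, so the two directional
    derivatives agree. *)
Lemma gradient_symmetric f x g (i j : 'I_n) : perm_invariant f -> pos_vec x ->
  is_gradient [set: 'cV[R]_n] f x g -> x i 0 = x j 0 -> g i 0 = g j 0.
Proof.
move=> fs x0 [_ fg] xij.
pose s := tperm i j.
have sx : perm_mx s *m x = x.
  apply/matrixP => k l; rewrite (ord1 l) -row_permE mxE.
  by rewrite /s; case: tpermP => [->|->|].
have gd k : frob_dot g (delta_mx k 0) = g k 0.
  rewrite frob_dot_cV (bigD1 k)//= mxE !eqxx mulr1 big1 ?addr0// => l lk.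
  by rewrite mxE (negPf lk) mulr0.
have si : perm_mx s *m delta_mx i (0 : 'I_1) = delta_mx j 0 :> 'cV[R]_n.
  apply/matrixP => k l; rewrite -row_permE !mxE /s; congr (_ && _)%:R.
  by rewrite -[X in _ == X](tpermR i j) (inj_eq perm_inj).
rewrite -!gd; have := fg (delta_mx j 0) I; apply: cvg_unique; first exact: norm_hausdorff.
have := fg (delta_mx i 0) I; apply: cvg_trans; apply: near_eq_cvg.
near=> t; have t0 : 0 < t by near: t; exact: nbhs_right_gt.
have xt : pos_vec (x + t *: delta_mx i 0).
  by move=> k; rewrite !mxE ltr_wpDr// mulr_ge0// ltW.
by rewrite -(fs _ xt s) mulmxDr -scalemxAr si sx.
Unshelve. all: by end_near. Qed.

End Gradients.

(** * The gradient of f o d *)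

Section Main.
Context {R : realType} {n : nat}.
Implicit Types (M A B H : 'M[R]_(n + n)) (x y g : 'cV[R]_n).
Local Notation J := (@Jmx R n).
Local Notation d := symplectic_eigenvalues.

(** An arbitrary choice of diagonalising matrix; it need not be continuous in [A], but stays bounded
    locally. *)
Definition frame A : 'M[R]_(n + n) :=
  xget 1%:M [set M | symplectic_mx M /\ M^T *m A *m M = double_diag (d A)].

Lemma frameP A : posdef_mx A ->
  symplectic_mx (frame A) /\ (frame A)^T *m A *m frame A = double_diag (d A).
Proof.
move=> /symplectic_eigenvaluesP[_ _ [M sM MA]].
by rewrite /frame; case: xgetP => [N _ //|/(_ M) []].
Qed.

Lemma symplectic_eigenvalues_cvg A : posdef_mx A ->
  d B @[B --> within sym_mx (nbhs A)] --> d A.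
Proof.
move=> Apd; have [L [e [L0 e0 LA]]] := symplectic_eigenvalues_lipschitz Apd.
apply/cvg_mxP => i j; rewrite (ord1 j); apply/cvgrPdistC_le => eps eps0.
apply/mx_nbhsP; exists (Num.min e (eps / L)); first by rewrite lt_min e0 divr_gt0.
move=> B BA Bsym; have [//||k l|_ dB _] := LA B (Num.min e (eps / L)).
- by rewrite ge_min lexx.
- exact/ltW/BA.
by apply: le_trans (dB i) _; rewrite mulrC -ler_pdivlMr// ge_min lexx orbT.
Qed.

Lemma near_sym_frame A : posdef_mx A ->
  exists2 L : R, 0 < L & \forall B \near within sym_mx (nbhs A),
    [/\ B \is symmetricmx, posdef_mx B & forall i k, `|frame B i k| <= L].
Proof.
move=> Apd; have [L [e [L0 e0 LA]]] := symplectic_eigenvalues_lipschitz Apd.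
exists L => //; apply/mx_nbhsP; exists e => // B BA Bsym.
have [k l|Bpd _ fB] := LA B e Bsym (lexx e); first exact/ltW/BA.
by split=> //; apply: fB; have [] := frameP Bpd.
Qed.

Lemma frame_gradB M g x : frame_grad M (g - x) = frame_grad M g - frame_grad M x.
Proof.
rewrite /frame_grad double_diagD -scaleN1r double_diagZ scaleN1r.
by rewrite mulmxBr mulmxBl scalerBr.
Qed.

Lemma frame_grad_le M g (L : R) i j : (forall k l, `|M k l| <= L) ->
  `|frame_grad M g i j| <= (n + n)%:R * L ^+ 2 * `|g|.
Proof.
move=> ML; have L0 : 0 <= L by apply: le_trans (ML i i).
rewrite /frame_grad mxE normrM; set s := `|2^-1|.
have s1 : s <= 1 by rewrite /s ger0_norm ?invr_ge0// invf_le1// ler1n.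
rewrite -[leRHS]mul1r; apply: ler_pM => //; first exact: normr_ge0.
rewrite double_diag_dbl mul_mx_diag mxE.
apply: le_trans (ler_norm_sum _ _ _) _.
apply: (@le_trans _ _ (\sum_(k < n + n) L ^+ 2 * `|g|)); last first.
  by rewrite sumr_const card_ord -[_ *+ (n + n)]mulr_natl mulrA.
apply: ler_sum => k _; rewrite !mxE -/(dbl g) !normrM mulrAC expr2.
rewrite ler_pM ?mulr_ge0// ?ler_pM//.
have := dblE g k; rewrite mxE => ->; exact: mx_entry_le_norm.
Qed.

(** * From [f] at [d A] to the composite at [A] *)

Section Forward.
Context (f : 'cV[R]_n -> R) (A : 'M[R]_(n + n)) (G : 'cV[R]_n -> 'cV[R]_n)
  (f_sym : perm_invariant f) (A_pd : posdef_mx A)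
  (fG : \forall y \near d A, is_gradient [set: 'cV[R]_n] f y (G y))
  (Gd : G y @[y --> d A] --> G (d A)).

Let grad B := frame_grad (frame B) (G (d B)).

(** The quotient of the composite is that of f along the bounded direction w t = (d(B + tH) - d(B))
    / t. It is asymptotic to the pairing of G (d B) with w t, whose limit is known. *)
Lemma is_gradient_spectral B (L e : R) : posdef_mx B -> 0 <= L -> 0 < e ->
  is_gradient [set: 'cV[R]_n] f (d B) (G (d B)) ->
  (forall z z', `|z - d B| < e -> `|z' - d B| < e -> `|f z' - f z| <= L * `|z' - z|) ->
  is_gradient sym_mx (f \o d) B (grad B).
Proof.
move=> Bpd L0 e0 fB fL; split; first exact: frame_grad_sym.
move=> H Hsym; have [sM MB] := frameP Bpd; have [b0 _ _] := symplectic_eigenvaluesP Bpd.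
have [W W0 HW] := symplectic_eigenvalues_rate Bpd Hsym.
pose w t : 'cV[R]_n := t^-1 *: (d (B + t *: H) - d B).
have wW : \forall t \near 0^'+, forall i, `|w t i 0| <= W.
  near=> t; move=> i; have t0 : 0 < t by near: t; exact: nbhs_right_gt.
  rewrite !mxE normrM normfV (gtr0_norm t0) mulrC ler_pdivrMr//.
  have [_] : posdef_mx (B + t *: H) /\ forall i, `|d (B + t *: H) i 0 - d B i 0| <= W * t.
    by near: t.
  exact.
have := gradient_bounded_direction fB L0 e0 fL wW.
have gs i j : d B i 0 = d B j 0 -> G (d B) i 0 = G (d B) j 0 := gradient_symmetric f_sym b0 fB.
have := eigen_weighted_deriv Bpd Hsym sM MB gs.
move=> lim1 lim2; rewrite -[frob_dot _ _]add0r; apply: cvg_trans (cvgD lim2 lim1).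
apply: near_eq_cvg; near=> t; have t0 : 0 < t by near: t; exact: nbhs_right_gt.
rewrite addrfctE /=; have -> : d B + t *: w t = d (B + t *: H).
  by rewrite /w scalerA divff ?gt_eqF// scale1r addrC subrK.
rewrite frob_dot_cV -addrA [X in _ + X](_ : _ = 0) ?addr0//.
apply/eqP; rewrite addrC subr_eq0; apply/eqP; apply: eq_bigr => i _.
by rewrite !mxE [t^-1 * _]mulrC.
Unshelve. all: by end_near. Qed.

Lemma is_gradient_spectral_near :
  \forall B \near within sym_mx (nbhs A), is_gradient sym_mx (f \o d) B (grad B).
Proof.
have [L [e [L0 e0 fL]]] := gradient_lipschitz fG Gd.
have [L1 _ fr] := near_sym_frame A_pd.
have dcv := symplectic_eigenvalues_cvg A_pd.
(* The ball of radius e/2 about [d B] stays in the ball of radius e about [d A]. *)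
have e20 : 0 < e / 2 by rewrite divr_gt0.
near=> B.
have [_ Bpd _] : [/\ B \is symmetricmx, posdef_mx B & forall i k, `|frame B i k| <= L1].
  by near: B; exact: fr.
have dBe : `|d B - d A| <= e / 2 by near: B; move/cvgrPdistC_le: dcv; apply.
apply: (@is_gradient_spectral B L (e / 2)) => //.
  near: B; exact: (dcv _ fG).
have inb z : `|z - d B| < e / 2 -> `|z - d A| < e.
  move=> zB; have -> : z - d A = (z - d B) + (d B - d A) by rewrite addrA subrK.
  by apply: le_lt_trans (ler_normD _ _) _; lra.
by move=> z z' zB zB'; apply: fL; exact: inb.
Unshelve. all: by end_near. Qed.

(** Frames may jump, so [grad B] is compared with the polynomial [Psi B], which uses the same frame
    with weights [q (d B)]. The difference is at most a constant times |G(d B) - q(d B)|, which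
    tends to 0 as [q] agrees with [G] at [d A]. *)
Lemma gradient_spectral_cvg : grad B @[B --> within sym_mx (nbhs A)] --> grad A.
Proof.
have dcv := symplectic_eigenvalues_cvg A_pd.
have [sM MA] := frameP A_pd; have [a0 _ _] := symplectic_eigenvaluesP A_pd.
have fA : is_gradient [set: 'cV[R]_n] f (d A) (G (d A)) := nbhs_singleton fG.
have gs i j : d A i 0 = d A j 0 -> G (d A) i 0 = G (d A) j 0 := gradient_symmetric f_sym a0 fA.
have [p pG] := odd_interpolation a0 gs.
pose q y := \sum_(k < size p) p`_k *: cmap (fun s => s ^+ k.*2.+1) y.
have qA : q (d A) = G (d A).
  apply/matrixP => i j; rewrite (ord1 j) pG summxE; apply: eq_bigr => k _.
  by rewrite !mxE.
pose Psi B := \sum_(k < size p)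
  p`_k *: ((2^-1 * (-1) ^+ k.+1) *: (mxpow (J *m B) k.*2.+1 *m J)).
have PsiE B : posdef_mx B -> Psi B = frame_grad (frame B) (q (d B)).
  move=> Bpd; have [sN NB] := frameP Bpd; rewrite frame_gradE.
  by apply: eq_bigr => k _; rewrite (frame_grad_pow k sN NB).
have [L L0 fr] := near_sym_frame A_pd.
have -> : grad A = Psi A by rewrite PsiE// qA.
have Psi_cvg : Psi B @[B --> within sym_mx (nbhs A)] --> Psi A.
  apply: cvg_big => [|k _]; first exact: add_continuous.
  apply: cvgZ; first exact: cvg_cst.
  apply: cvgZ; first exact: cvg_cst.
  apply: cvg_mulmx; last exact: cvg_cst.
  apply: cvg_mxpow; apply: cvg_mulmx; first exact: cvg_cst.
  exact: cvg_within.
have q_cvg : q (d B) @[B --> within sym_mx (nbhs A)] --> q (d A).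
  apply: cvg_big => [|k _]; first exact: add_continuous.
  apply: cvgZ; first exact: cvg_cst.
  apply/cvg_mxP => i j; rewrite mxE; under eq_fun do rewrite mxE.
  apply: (@cvg_comp _ _ _ (fun B => d B i j) (fun s => s ^+ k.*2.+1) _ (nbhs (d A i j))).
    by move/cvg_mxP: dcv; apply.
  exact: exprn_continuous.
apply/cvg_mxP => i j.
apply: (@cvgr_near_dist _ _ _ _ _ (fun B => Psi B i j)
  (fun B => (n + n)%:R * L ^+ 2 * `|G (d B) - q (d B)|)).
- apply: filterS fr => B [_ Bpd frB].
  have entryB (X Y : 'M[R]_(n + n)) : X i j - Y i j = (X - Y) i j by rewrite !mxE.
  by rewrite PsiE// entryB -frame_gradB frame_grad_le.
- have : (n + n)%:R * L ^+ 2 * `|G (d B) - q (d B)| @[B --> within sym_mx (nbhs A)] -->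
      (n + n)%:R * L ^+ 2 * `|G (d A) - q (d A)|.
    apply: cvgM; first exact: cvg_cst.
    apply: cvg_norm; apply: cvgB => //.
    exact: (cvg_comp _ _ dcv Gd).
  by rewrite qA subrr normr0 mulr0.
- by move/cvg_mxP: Psi_cvg; apply.
Qed.

End Forward.

(** * From the composite at [A] to [f] at [d A] *)

Section Backward.
Context (f : 'cV[R]_n -> R) (A : 'M[R]_(n + n)) (G : 'M[R]_(n + n) -> 'M[R]_(n + n))
  (f_sym : perm_invariant f) (A_pd : posdef_mx A)
  (fG : \forall B \near within sym_mx (nbhs A), is_gradient sym_mx (f \o d) B (G B))
  (GA : G B @[B --> within sym_mx (nbhs A)] --> G A).

(* [f] is [f \o d] restricted to the affine slice of matrices diagonalised by the
   same frame as [A]. *)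
Let slice x := (invmx (frame A))^T *m double_diag x *m invmx (frame A).

Let slice_sym x : slice x \is symmetricmx.
Proof. by apply/symmetricmxP; rewrite /slice !trmx_mul trmxK double_diag_tr mulmxA. Qed.

(** The frame of [A] brings the slice to diagonal form x, so its symplectic eigenvalues are x
    reordered, which f ignores. *)
Let sliceE x : pos_vec x -> f (d (slice x)) = f x.
Proof.
move=> x0; have [sM _] := frameP A_pd; have uM := symplectic_unitmx sM.
have Mx : (frame A)^T *m slice x *m frame A = double_diag x.
  rewrite /slice !mulmxA -trmx_mul mulVmx// trmx1 mul1mx.
  by rewrite -mulmxA mulVmx// mulmx1.
have [s xs] := is_symplectic_spectrum_perm x0 sM Mx.
by rewrite (symplectic_eigenvaluesE xs) f_sym.
Qed.

Let slice_d : slice (d A) = A.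
Proof.
have [sM MA] := frameP A_pd; have uM := symplectic_unitmx sM.
rewrite /slice -MA !mulmxA -trmx_mul mulmxV// trmx1 mul1mx.
by rewrite -mulmxA mulmxV// mulmx1.
Qed.

Let slice_sum x : slice x = \sum_i x i 0 *: slice (delta_mx i 0).
Proof.
have {1}-> : x = \sum_i x i 0 *: delta_mx i 0.
  apply/matrixP => i j; rewrite (ord1 j) summxE (bigD1 i)//= !mxE !eqxx mulr1.
  by rewrite big1 ?addr0// => k ki; rewrite !mxE eq_sym (negPf ki) mulr0.
rewrite /slice double_diag_sum mulmx_sumr mulmx_suml; apply: eq_bigr => i _.
by rewrite -scalemxAr -scalemxAl.
Qed.

Let slice_line x u t : slice (x + t *: u) = slice x + t *: slice u.
Proof.
by rewrite /slice double_diagD double_diagZ mulmxDr mulmxDl -scalemxAr -scalemxAl.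
Qed.

Let slice_cvg : slice x @[x --> d A] --> within sym_mx (nbhs A).
Proof.
have sA : slice x @[x --> d A] --> slice (d A).
  have -> : slice = (fun x => \sum_i x i 0 *: slice (delta_mx i 0)).
    by apply/funext => x; exact: slice_sum.
  apply: (@cvg_big 'M[R]_(n + n) _ +%R 0 predT _ _ (nbhs (d A))) => [|i _].
    exact: add_continuous.
  by apply: cvgZ; [exact: coord_continuous|exact: cvg_cst].
rewrite slice_d in sA; move=> P AP.
have AP' : nbhs (d A) (fun x => sym_mx (slice x) -> P (slice x)) := sA _ AP.
by apply: filterS AP' => x; apply; exact: slice_sym.
Qed.

(** The chain rule: the adjoint of the linear map [slice] applied to the gradient of the
    composite. *)
Let gradf x : 'cV[R]_n := \col_i frob_dot (G (slice x)) (slice (delta_mx i 0)).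

Lemma near_pos_vec x : pos_vec x -> \forall y \near x, pos_vec y.
Proof.
move=> x0; apply: (@filter_forall _ _ (fun i (y : 'cV[R]_n) => 0 < y i 0) (nbhs x)) => i.
have : (y : 'cV[R]_n) i 0 @[y --> x] --> x i 0 by exact: coord_continuous.
by move/cvgr_gt; apply; exact: x0.
Qed.

Lemma is_gradient_slice x : pos_vec x -> is_gradient sym_mx (f \o d) (slice x) (G (slice x)) ->
  is_gradient [set: 'cV[R]_n] f x (gradf x).
Proof.
move=> x0 [_ fGx]; split=> // u _.
have -> : frob_dot (gradf x) u = frob_dot (G (slice x)) (slice u).
  rewrite (slice_sum u) frob_dot_cV /frob_dot mulmx_sumr linear_sum /=.
  by apply: eq_bigr => i _; rewrite mxE -scalemxAr linearZ /= mulrC.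
apply: cvg_trans (fGx _ (slice_sym u)); apply: near_eq_cvg.
have xu : x + t *: u @[t --> 0^'+] --> x.
  apply: cvg_right0.
  have : x + t *: u @[t --> (0 : R)] --> x + 0 *: u.
    by apply: cvgD; [exact: cvg_cst|apply: cvgZ; [exact: cvg_id|exact: cvg_cst]].
  by rewrite scale0r addr0.
(* [sliceE] is available at positive vectors only, so t is kept small. *)
have xt : \forall t \near 0^'+, pos_vec (x + t *: u) := xu _ (near_pos_vec x0).
apply: filterS xt => t xt.
by rewrite /= -slice_line !sliceE.
Qed.

Lemma is_gradient_slice_near : \forall x \near d A, is_gradient [set: 'cV[R]_n] f x (gradf x).
Proof.
have [a0 _ _] := symplectic_eigenvaluesP A_pd.
near=> x; apply: is_gradient_slice; first by near: x; exact: near_pos_vec.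
by near: x; exact: (slice_cvg fG).
Unshelve. all: by end_near. Qed.

Lemma gradient_slice_cvg : gradf x @[x --> d A] --> gradf (d A).
Proof.
apply: (proj2 (cvg_mxP (F := nbhs (d A)) _ _)) => i j.
rewrite mxE; under eq_fun do rewrite mxE.
apply: (cvg_mxtrace (F := nbhs (d A))).
apply: (cvg_mulmx (F := nbhs (d A))); last exact: cvg_cst.
apply: (cvg_trmx (F := nbhs (d A))); rewrite slice_d.
exact: (cvg_comp _ _ slice_cvg GA).
Qed.

End Backward.
End Main.

Theorem corollary3p17 (R : realType) (n : nat) (n_gt0 : (0 < n)%N)
    (f : 'cV[R]_n -> R) (f_sym : perm_invariant f)
    (A : 'M[R]_(n + n)) (A_pd : posdef_mx A) :
  continuously_gateaux_at sym_mx (f \o symplectic_eigenvalues) A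
  <-> continuously_gateaux_at [set: 'cV[R]_n] f (symplectic_eigenvalues A).
Proof.
split=> -[G [fG Gd]].
  eexists; rewrite withinET; split; first exact: (is_gradient_slice_near f_sym A_pd fG).
  exact: (gradient_slice_cvg A_pd Gd).
move: fG Gd; rewrite withinET => fG Gd; eexists.
split; first exact: (is_gradient_spectral_near f_sym A_pd fG Gd).
exact: (gradient_spectral_cvg f_sym A_pd fG Gd).
Qed.
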